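(* Let $\mu$ be a nonnegative Borel measure on $\mathbb{R}^+$ with $\mu(\mathbb{R}^+)\in(0,\infty)$, let $\sigma\in C(\mathbb{R}^+;\mathbb{R})$ with $\sigma\notin L^2(0,\infty)$, let $B$ be a standard one-dimensional Brownian motion, and let $f:\mathbb{R}\to\mathbb{R}$ be locally Lipschitz continuous with $\lim_{x\to\infty}f(x)=\infty$. Suppose there is $\phi\in C^1(\mathbb{R}^+;(0,\infty))$ with $\phi'(x)>0$ for all $x\ge0$, $\lim_{x\to\infty}\phi(x)=\infty$, $\phi'$ non-increasing with $\lim_{x\to\infty}\phi'(x)=0$, and $$\lim_{x\to\infty}\frac{f(x)}{\phi(x)}=1,\qquad\lim_{|x|\to\infty}\frac{|f(x)|}{\phi(|x|)}=1.$$ Let $X$ be the unique strong (continuous) solution of $$X(t)=X(0)+\int_0^t m(t-s)f(X(s))\,ds+\int_0^t\sigma(s)\,dB(s),\quad t\ge0,\qquad m(t)=\mu([0,t]).$$ Let $$\Sigma(t)=\sqrt{2\left(\int_0^t\sigma^2(s)\,ds\right)\log\log\left(\int_0^t\sigma^2(s)\,ds\right)},\qquad L_f(\Sigma)=\lim_{t\to\infty}\frac{\Sigma(t)}{\mu(\mathbb{R}^+)\int_{t_0}^t f(\Sigma(s))\,ds}.$$ If the limit $L_f(\Sigma)$ exists and $L_f(\Sigma)\in(1,\infty)$, then $$\frac{-L_f(\Sigma)}{L_f(\Sigma)-1}\le\liminf_{t\to\infty}\frac{X(t)}{\Sigma(t)}\le\limsup_{t\to\infty}\frac{X(t)}{\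Sigma(t)}\le\frac{L_f(\Sigma)}{L_f(\Sigma)-1}\quad\text{a.s.}$$
   Context: $\mathbb{R}^+=[0,\infty)$. The underlying filtered probability space is complete with right-continuous filtration, $B$ is a Brownian motion with respect to it, and $X(0)$ is a real-valued $\mathcal{F}_0$-measurable initial value. $\Sigma(t)$ is considered only for $t\ge t_0$, where $t_0$ is any fixed time with $\int_0^{t_0}\sigma^2(s)\,ds>e$ (the value of $L_f(\Sigma)$ does not depend on the choice of $t_0$). *)

(* Defs.v *)
From HB Require Import structures.
From mathcomp Require Import all_boot all_order all_algebra.
From mathcomp Require Import all_classical all_reals all_analysis.

Set Implicit Arguments.
Unset Strict Implicit.
Unset Printing Implicit Defensive.

Import Order.TTheory GRing.Theory Num.Theory.
Import numFieldNormedType.Exports.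

Local Open Scope classical_set_scope.
Local Open Scope ring_scope.

(* Time is [0, +oo[.  Functions of time, processes and filtrations are indexed
   by all of R, but only their values at nonnegative times are ever used. *)

Section deterministic.
Context {R : realType}.

(* Neighbourhoods of infinity for |x| -> +oo on the real line. *)
Definition abs_pinfty_nbhs : set_system R :=
  [set A | exists M : R, forall x, M < `|x| -> A x].

(* phi is C^1 on the closed half-line with derivative dphi; the derivative is
   the limit of difference quotients within [0, +oo[, so it is one-sided at 0. *)
Definition C1_with_derivative (phi dphi : R -> R) : Prop :=
  (forall x : R, 0 <= x ->
    (phi y - phi x) / (y - x) @[y --> within `[0, +oo[%classic x^'] --> dphi x) /\
  {within `[0, +oo[, continuous dphi}.

(* Only the restriction of mu to the Borel subsets of [0, +oo[ is used. *)
Definition total_mass (mu : {measure set (measurableTypeR R) -> \bar R}) : R :=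
  fine (mu `[0, +oo[%classic).

Definition kernel_of (mu : {measure set (measurableTypeR R) -> \bar R})
    (t : R) : R :=
  fine (mu `[0, t]%classic).

Definition quad_var (sigma : R -> R) (t : R) : R :=
  \int[lebesgue_measure]_(s in `[0, t]) sigma s ^+ 2.

(* Meaningful only when quad_var sigma t > e: otherwise the library's
   conventions for ln and sqrt outside their domains apply. *)
Definition Sigma (sigma : R -> R) (t : R) : R :=
  Num.sqrt (2 * quad_var sigma t * ln (ln (quad_var sigma t))).

(* The quotient whose limit at +oo is L_f(Sigma). *)
Definition Sigma_ratio (mu : {measure set (measurableTypeR R) -> \bar R})
    (f sigma : R -> R) (t0 t : R) : R :=
  Sigma sigma t /
    (total_mass mu * \int[lebesgue_measure]_(s in `[t0, t]) f (Sigma sigma s)).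

(* A step function is a finite list of triples (c, (a, b)), each standing for
   c * 1_]a, b]; the intervals may overlap. *)
Definition step_on (t : R) (h : seq (R * (R * R))) : Prop :=
  forall p, p \in h -> [/\ 0 <= p.2.1, p.2.1 <= p.2.2 & p.2.2 <= t].

Definition step_eval (h : seq (R * (R * R))) (s : R) : R :=
  \sum_(p <- h) p.1 * \1_`]p.2.1, p.2.2] s.

End deterministic.

Section stochastic.
Context {d : measure_display} {T : measurableType d} {R : realType}.
Variable P : probability T R.

(* A filtration satisfying the usual conditions: complete and
   right-continuous. *)
Record usual_filtration (F : R -> set (set T)) : Prop := UsualFiltration {
  filtration_sigma : forall t : R, 0 <= t -> sigma_algebra [set: T] (F t) ;
  filtration_measurable : forall t : R, 0 <= t -> F t `<=` measurable ;
  filtration_le : forall s t : R, 0 <= s -> s <= t -> F s `<=` F t ;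
  filtration_complete : forall t : R, 0 <= t -> P.-negligible `<=` F t ;
  filtration_right_continuous :
    forall t : R, 0 <= t -> \bigcap_(s in `]t, +oo[) F s = F t }.

Definition sub_measurable (G : set (set T)) (Y : T -> R) : Prop :=
  forall C : set (measurableTypeR R), measurable C -> G (Y @^-1` C).

Definition adapted (F : R -> set (set T)) (Y : R -> T -> R) : Prop :=
  forall t : R, 0 <= t -> sub_measurable (F t) (Y t).

Definition continuous_paths (Y : R -> T -> R) : Prop :=
  {ae P, forall w, {within `[0, +oo[, continuous (Y ^~ w)}}.

(* The second parameter of normal_prob is the standard deviation. *)
Record brownian_motion (F : R -> set (set T)) (B : R -> T -> R) : Prop :=
  BrownianMotion {
  brownian_adapted : adapted F B ;
  brownian_continuous : continuous_paths B ;
  brownian0 : {ae P, forall w, B 0 w = 0} ;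
  brownian_normal : forall s t : R, 0 <= s -> s < t ->
    forall C : set (measurableTypeR R), measurable C ->
      P ((B t \- B s) @^-1` C) = normal_prob 0 (Num.sqrt (t - s)) C ;
  brownian_independent : forall s t : R, 0 <= s -> s < t ->
    forall (A : set T) (C : set (measurableTypeR R)), F s A -> measurable C ->
      P (A `&` (B t \- B s)%R @^-1` C) = (P A * P ((B t \- B s)%R @^-1` C))%E }.

Definition step_integral (B : R -> T -> R) (h : seq (R * (R * R))) (w : T) : R :=
  \sum_(p <- h) p.1 * (B p.2.2 w - B p.2.1 w).

(* Ito integral over [0, t] of a deterministic integrand: the L^2(P) limit of
   the elementary integrals along any step functions converging to sigma in
   L^2(0, t).  Such step functions exist whenever sigma is continuous, and by
   the isometry the limit does not depend on them. *)
Definition is_ito_integral (B : R -> T -> R) (sigma : R -> R) (t : R)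
    (I : T -> R) : Prop :=
  forall h : nat -> seq (R * (R * R)),
    (forall k, step_on t (h k)) ->
    (\int[lebesgue_measure]_(s in `[0%R, t])
       ((sigma s - step_eval (h k) s) ^+ 2)%:E)%E @[k --> \oo] --> 0%E ->
    (\int[P]_w ((I w - step_integral B (h k) w) ^+ 2)%:E)%E @[k --> \oo]
      --> 0%E.

(* The continuous adapted version of t |-> \int_0^t sigma dB. *)
Definition is_ito_process (F : R -> set (set T)) (B : R -> T -> R)
    (sigma : R -> R) (M : R -> T -> R) : Prop :=
  [/\ adapted F M, continuous_paths M &
      forall t : R, 0 <= t -> is_ito_integral B sigma t (M t)].

Definition is_strong_solution (F : R -> set (set T)) (B : R -> T -> R)
    (m f sigma : R -> R) (X0 : T -> R) (X : R -> T -> R) : Prop :=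
  [/\ adapted F X, continuous_paths X &
      exists2 M : R -> T -> R, is_ito_process F B sigma M &
        {ae P, forall w, forall t : R, 0 <= t ->
          X t w = X0 w
            + \int[lebesgue_measure]_(s in `[0, t]) (m (t - s) * f (X s w))
            + M t w}].

End stochastic.

(* Main.v *)
(* The noise M(t) = int_0^t sigma dB is approximated in L^2 by step integrals
   whose coefficients minimise |sigma| on each interval, so that
   E exp(theta M(t)) <= exp(theta^2 q(t) / 2) with q the quadratic variation.
   A first-passage argument bounds the running maximum of M, and Borel-Cantelli along times t_n
   with q(t_n) = kappa^(n+1) yields limsup |M| / Sigma <= 1 almost surely.

   The rest is pathwise.  The derivative of phi is non-increasing, so
   phi(c y) <= c phi(y) for c >= 1; hence |X| <= lam Sigma on [T, t] with
   lam >= 1 entails, up to small errors,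
     |X(t)| <= C + lam mu(R+) int_T^t f(Sigma) + Sigma(t)
            <= C + (lam / L + 1) Sigma(t).
   As 1 / L < 1 this first bounds |X| / Sigma, and then, iterated, brings the
   bound down to the fixed point L / (L - 1) of lam |-> lam / L + 1. *)
Require Import Defs.
From HB Require Import structures.
From mathcomp Require Import all_boot all_order all_algebra.
From mathcomp Require Import all_classical all_reals all_analysis.
From mathcomp Require Import measurable_realfun ring lra.

Import Order.TTheory GRing.Theory Num.Theory.
Import numFieldNormedType.Exports.

Local Open Scope classical_set_scope.
Local Open Scope ring_scope.

Set Implicit Arguments.
Unset Strict Implicit.
Unset Printing Implicit Defensive.

(** * Normal laws and independence *)

(** The Ito integral is only given as an L^2 limit of step integrals, so neither its law nor its
    martingale property is at hand. Just two facts are carried to the limit: the inequality for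
    exponential moments, rather than the Gaussian law itself, and the vanishing mean of M t - M s
    over events of F s. Minimal coefficients make the inequality hold for every step integral
    without an error term. The two facts suffice for the maximal inequality, because exp y >= 1 + y
    stands in for conditional expectations.

    The ratio kappa between consecutive levels of q is also the factor put in front of Sigma: of the
    square kappa^2 of the threshold, one factor is lost to the larger variance at t_(n+1), and the
    remaining exponent kappa > 1 makes the Borel-Cantelli series converge.

    Only the upper half of the law of the iterated logarithm is used, because |X| is estimated as a
    whole: one bound on |X| / Sigma yields both the limsup and the liminf. The restriction lam >= 1
    is harmless, as the fixed point exceeds 1. *)

Section normal.
Context {R : realType}.
Import HBNNSimple.
Local Notation leb := (@lebesgue_measure R).

(** [normal_prob] is defined by integrating its density, which settles indicators; simple functions
    and then monotone convergence along [nnsfun_approx] give the rest. *)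
Lemma ge0_integral_normal_prob (m s : R) (g : _ -> \bar R) :
  measurable_fun setT g -> (forall x, 0 <= g x)%E ->
  (\int[normal_prob m s]_x g x =
   \int[leb]_x (g x * (normal_pdf m s x)%:E))%E.
Proof.
move=> mg g0.
have mpdf : measurable_fun [set: R] (EFin \o normal_pdf m s).
  by apply/measurable_EFinP; exact: measurable_normal_pdf.
have pdf0 x : (0 <= (normal_pdf m s x)%:E)%E by rewrite lee_fin normal_pdf_ge0.
pose h := nnsfun_approx measurableT mg.
have gE x : g x = limn (fun n => (h n x)%:E).
  by apply/esym/cvg_lim => //; exact: cvg_nnsfun_approx.
transitivity (limn (fun n => \int[normal_prob m s]_x (h n x)%:E)%E).
  under eq_integral do rewrite gE.
  apply: monotone_convergence => //.
  - by move=> n; exact/measurable_EFinP.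
  - by move=> n x _; rewrite lee_fin.
  - by move=> x _ a b ab; rewrite lee_fin; exact/lefP/nd_nnsfun_approx.
transitivity (limn (fun n => \int[leb]_x
    ((h n x)%:E * (normal_pdf m s x)%:E))%E); last first.
  under [RHS]eq_integral => x _.
    have -> : (g x * (normal_pdf m s x)%:E =
        limn (fun n => (h n x)%:E * (normal_pdf m s x)%:E))%E.
      apply/esym/cvg_lim => //; apply: cvgeZr => //.
      exact: cvg_nnsfun_approx.
    over.
  apply/esym/monotone_convergence => //.
  - by move=> n; apply: emeasurable_funM => //; exact/measurable_EFinP.
  - by move=> n x _; rewrite mule_ge0// lee_fin.
  - move=> x _ a b ab; rewrite lee_wpmul2r// lee_fin.
    exact/lefP/nd_nnsfun_approx.
congr (limn _); apply/funext => n.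
transitivity (\int[normal_prob m s]_x
   (\sum_(y \in range (h n)) (y * \1_(h n @^-1` [set y]) x)%:E))%E.
  by apply: eq_integral => t _; rewrite fimfunE -fsumEFin.
rewrite ge0_integral_fsum//; last 2 first.
  - by move=> r; exact/measurable_EFinP/measurableT_comp.
  - by move=> r x _; exact: nnfun_muleindic_ge0.
transitivity (\int[leb]_x (\sum_(y \in range (h n))
    ((y * \1_(h n @^-1` [set y]) x)%:E * (normal_pdf m s x)%:E)))%E; last first.
  apply: eq_integral => x _.
  rewrite -ge0_mule_fsuml => [|y]; last exact: nnfun_muleindic_ge0.
  by rewrite fsumEFin // -(fimfunE _ x).
rewrite ge0_integral_fsum//; last 2 first.
  - move=> r; apply: emeasurable_funM => //.
    exact/measurable_EFinP/measurableT_comp.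
  - by move=> r x _; rewrite mule_ge0// nnfun_muleindic_ge0.
apply: eq_fsbigr => r; rewrite inE => -[t _ rE].
have r0 : 0 <= r by rewrite -rE.
have mr : measurable (h n @^-1` [set r]) by exact: measurable_sfunP.
under eq_integral do rewrite EFinM.
rewrite ge0_integralZl//; last exact/measurable_EFinP.
rewrite integral_indic// setIT.
under [RHS]eq_integral do rewrite EFinM -muleA.
rewrite ge0_integralZl//; last 2 first.
  - by apply: emeasurable_funM => //; exact/measurable_EFinP.
  - by move=> x _; rewrite mule_ge0// lee_fin.
congr (_ * _)%E.
transitivity (\int[leb]_(x in h n @^-1` [set r]) (normal_pdf m s x)%:E)%E.
  by [].
rewrite [LHS]integral_mkcond.
by apply: eq_integral => x _; rewrite epatch_indic muleC.
Qed.

(** Completing the square: tilting the centred density by exp (th x) moves its mean to th s^2, up to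
    the constant on the right. *)
Lemma normal_mgf (s th : R) : s != 0 ->
  (\int[normal_prob 0 s]_x (expR (th * x))%:E =
   (expR (th ^+ 2 * s ^+ 2 / 2))%:E)%E.
Proof.
move=> s0; rewrite ge0_integral_normal_prob//; last first.
  by apply/measurable_EFinP/measurableT_comp => //; exact: measurable_funM.
transitivity (\int[leb]_x ((expR (th ^+ 2 * s ^+ 2 / 2))%:E *
    (normal_pdf (th * s ^+ 2) s x)%:E))%E.
  apply: eq_integral => x _; rewrite -!EFinM !normal_pdfE//; congr EFin.
  rewrite [in LHS]mulrCA [in RHS]mulrCA; congr (_ * _).
  rewrite /normal_fun -!expRD; congr expR.
  by field.
rewrite ge0_integralZl//.
- by rewrite integral_normal_pdf mule1.
- by apply/measurable_EFinP; exact: measurable_normal_pdf.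
- by move=> x _; rewrite lee_fin normal_pdf_ge0.
Qed.
End normal.

Section independence.
Context {d : measure_display} {T : measurableType d} {R : realType}.
Variable P : probability T R.

(** The product formula on rectangles identifies the joint law with the product of the marginal
    laws, and Tonelli then separates the factors. *)
Lemma ge0_integral_independent (X Y : T -> R) (g h : R -> \bar R) :
  measurable_fun setT X -> measurable_fun setT Y ->
  (forall A C : set R, measurable A -> measurable C ->
    P (X @^-1` A `&` Y @^-1` C) = (P (X @^-1` A) * P (Y @^-1` C))%E) ->
  measurable_fun setT g ->
  measurable_fun setT h ->
  (forall x, 0 <= g x)%E -> (forall x, 0 <= h x)%E ->
  (\int[P]_w (g (X w) * h (Y w)) =
   \int[P]_w g (X w) * \int[P]_w h (Y w))%E.
Proof.
move=> mX mY XY mg mh g0 h0.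
pose X' : {RV P >-> R} := HB.pack X (isMeasurableFun.Build _ _ _ _ X mX).
pose Y' : {RV P >-> R} := HB.pack Y (isMeasurableFun.Build _ _ _ _ Y mY).
pose XYf := fun w => (X w, Y w).
have mXY : measurable_fun setT (XYf : T -> R * R).
  exact: measurable_fun_pair.
pose XY' : {RV P >-> (R * R)%type} :=
  HB.pack XYf (isMeasurableFun.Build _ _ _ _ XYf mXY).
have lawE : forall A, measurable A ->
  (distribution P X' \x distribution P Y')%E A = distribution P XY' A.
  apply: (@product_measure_unique _ _ _ _ _ (distribution P X')
    (distribution P Y') (distribution P XY')) => A B mA mB.
  by rewrite /distribution /pushforward/= -XY.
pose G (z : R * R) := (g z.1 * h z.2)%E.
have mG : measurable_fun setT G.
  apply: emeasurable_funM.
    exact: (measurableT_comp mg measurable_fst).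
  exact: (measurableT_comp mh measurable_snd).
have G0 z : (0 <= G z)%E by rewrite mule_ge0.
transitivity (\int[distribution P XY']_z G z)%E.
  by rewrite ge0_integral_distribution.
transitivity (\int[(distribution P X' \x distribution P Y')]_z G z)%E.
  by apply: eq_measure_integral => A mA _; exact/esym/lawE.
rewrite fubini_tonelli1// /fubini_F /G/=.
have h00 : (0 <= \int[distribution P Y']_y h y)%E by exact: integral_ge0.
under eq_integral do rewrite ge0_integralZl//.
rewrite ge0_integralZr//.
by rewrite !ge0_integral_distribution.
Qed.
End independence.

(** * Exponential moments of Brownian increments *)

Section sub_measurable.
Context {d : measure_display} {T : measurableType d} {R : realType}.
Context {G : set (set T)} (algG : sigma_algebra [set: T] G).

(** Viewing G as a measurable structure of its own makes the closure properties of measurable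
    functions available for [sub_measurable]. *)
Lemma sub_measurableP (Y : T -> R) :
  sub_measurable G Y <->
  measurable_fun [set: g_sigma_algebraType G] (Y : g_sigma_algebraType G -> R).
Proof.
split=> [GY _ C mC|mY C mC].
- by rewrite setTI measurable_g_measurableTypeE//; exact: GY.
- have := mY measurableT C mC.
  by rewrite setTI measurable_g_measurableTypeE.
Qed.

Lemma sub_measurableD (X Y : T -> R) :
  sub_measurable G X -> sub_measurable G Y -> sub_measurable G (X \+ Y).
Proof.
by move=> /sub_measurableP mX /sub_measurableP mY; apply/sub_measurableP;
  exact: measurable_funD.
Qed.

Lemma sub_measurable_comp (g : R -> R) (Y : T -> R) :
  measurable_fun setT g -> sub_measurable G Y -> sub_measurable G (g \o Y).
Proof.
by move=> mg /sub_measurableP mY; apply/sub_measurableP;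
  exact: measurableT_comp.
Qed.

Lemma sub_measurable_cst (c : R) : sub_measurable G (cst c).
Proof. by apply/sub_measurableP; exact: measurable_cst. Qed.

Lemma sub_measurable_indic (A : set T) :
  G A -> sub_measurable G (\1_A : T -> R).
Proof.
move=> GA; apply/sub_measurableP; apply: measurable_indic.
by rewrite measurable_g_measurableTypeE.
Qed.

Lemma sigma_algebra_setU (A C : set T) : G A -> G C -> G (A `|` C).
Proof.
rewrite -(sigma_algebra_id algG) => GA GC.
exact: (@measurableU _ (g_sigma_algebraType G)).
Qed.

Lemma sigma_algebra_setD (A C : set T) : G A -> G C -> G (A `\` C).
Proof.
rewrite -(sigma_algebra_id algG) => GA GC.
exact: (@measurableD _ (g_sigma_algebraType G)).
Qed.

End sub_measurable.

Section brownian.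
Context {d : measure_display} {T : measurableType d} {R : realType}.
Context {P : probability T R} {F : R -> set (set T)} {B : R -> T -> R}.
Hypotheses (usual_F : usual_filtration P F) (brownian_B : brownian_motion P F B).

Lemma adapted_measurable (Y : R -> T -> R) (t : R) :
  adapted F Y -> 0 <= t -> measurable_fun setT (Y t).
Proof.
move=> aY t0 _ C mC; rewrite setTI.
by apply: (filtration_measurable usual_F t0); exact: aY.
Qed.

Lemma measurable_brownianB (s t : R) : 0 <= s -> 0 <= t ->
  measurable_fun setT (B t \- B s).
Proof.
have aB := brownian_adapted brownian_B.
by move=> s0 t0; apply: measurable_funB; exact: adapted_measurable.
Qed.

Lemma expectation_expR_brownianB (s t th : R) (Y : T -> R) :
  0 <= s -> s <= t -> sub_measurable (F s) Y -> (forall w, 0 <= Y w) ->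
  (\int[P]_w (Y w * expR (th * (B t w - B s w)))%:E =
   \int[P]_w (Y w)%:E * (expR (th ^+ 2 * (t - s) / 2))%:E)%E.
Proof.
(* Normality and independence of increments are only given for s < t, so s = t is treated apart. *)
move=> s0; rewrite le_eqVlt => /predU1P[<-|st] FY Y0.
  rewrite !subrr mulr0 mul0r expR0 mule1.
  by apply: eq_integral => w _; rewrite subrr mulr0 expR0 mulr1.
have t0 : 0 <= t by rewrite (le_trans s0) ?ltW.
have mY : measurable_fun setT Y.
  move=> _ C mC; rewrite setTI.
  by apply: (filtration_measurable usual_F s0); exact: FY.
have mB := measurable_brownianB s0 t0.
have mexp : measurable_fun setT (fun x : R => (expR (th * x))%:E).
  by apply/measurable_EFinP/measurableT_comp => //; exact: measurable_funM.
(* The independence lemma wants a function that is nonnegative on the whole line, hence the absolute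
   value instead of the identity. *)
transitivity (\int[P]_w (`|Y w|%:E * (expR (th * (B t \- B s) w))%:E))%E.
  by apply: eq_integral => w _; rewrite ger0_norm.
rewrite (@ge0_integral_independent _ _ _ P Y (B t \- B s)
    (fun x => `|x|%:E) (fun x => (expR (th * x))%:E))//.
- congr (_ * _)%E.
    by apply: eq_integral => w _; rewrite ger0_norm.
  transitivity (\int[normal_prob 0 (Num.sqrt (t - s))]_x (expR (th * x))%:E)%E.
    have mB' : @measurable_fun _ _ T (measurableTypeR R) setT (B t \- B s) by [].
    pose D : {RV P >-> measurableTypeR R} := HB.pack (B t \- B s)
      (isMeasurableFun.Build _ _ T (measurableTypeR R) (B t \- B s) mB').
    rewrite -(@ge0_integral_distribution _ _ _ _ _ P D
      (fun x => (expR (th * x))%:E))//.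
    apply: eq_measure_integral => A mA _.
    exact: (brownian_normal brownian_B).
  by rewrite normal_mgf ?sqr_sqrtr ?gt_eqF ?sqrtr_gt0 ?subr_gt0// subr_ge0 ltW.
- move=> A C mA mC.
  by apply: (brownian_independent brownian_B) => //; exact: FY.
- by apply/measurable_EFinP; exact: normr_measurable.
Qed.

Lemma expR_brownianB_integrable (s t c : R) : 0 <= s -> s <= t ->
  P.-integrable setT (fun w => (expR (c * (B t w - B s w)))%:E).
Proof.
move=> s0 st; have t0 : 0 <= t := le_trans s0 st.
apply/integrableP; split.
  apply/measurable_EFinP/measurableT_comp => //.
  by apply: measurable_funM => //; exact: measurable_brownianB.
under eq_integral do rewrite gee0_abs ?lee_fin ?expR_ge0//.
rewrite (eq_integral (fun w => (cst 1 w * expR (c * (B t w - B s w)))%:E)).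
  rewrite expectation_expR_brownianB//; last first.
    exact: sub_measurable_cst (filtration_sigma usual_F s0) _.
  by rewrite /= integral_cst//= probability_setT mule1 -EFinM ltry.
by move=> w _ /=; rewrite mul1r.
Qed.

(** Domination by |x| <= exp x + exp (- x) makes the exponential moments sufficient. *)
Lemma brownianB_integrable (s t : R) : 0 <= s -> s <= t ->
  P.-integrable setT (EFin \o (B t \- B s)).
Proof.
move=> s0 st; have t0 : 0 <= t := le_trans s0 st.
have := integrableD measurableT (expR_brownianB_integrable 1 s0 st)
  (expR_brownianB_integrable (-1) s0 st).
apply: le_integrable => //.
  by apply/measurable_EFinP; exact: measurable_brownianB.
move=> w _ /=; rewrite mul1r mulN1r lee_fin.
rewrite [leRHS]ger0_norm ?addr_ge0 ?expR_ge0//.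
set x := B t w - B s w.
have := expR_ge1Dx x; have := expR_ge1Dx (- x).
have := expR_ge0 x; have := expR_ge0 (- x).
by rewrite ler_norml; lra.
Qed.

Lemma integral_brownianB0 (A : set T) (s u v : R) :
  0 <= s -> s <= u -> u <= v -> F s A ->
  (\int[P]_(w in A) (B v w - B u w)%:E = 0)%E.
Proof.
move=> s0 su uv FA; have u0 : 0 <= u := le_trans s0 su.
have {su}FuA : F u A by exact: (filtration_le usual_F s0 su).
have mA : measurable A by exact: (filtration_measurable usual_F u0).
have iB : P.-integrable A (EFin \o (B v \- B u)).
  by apply: (integrableS measurableT) => //; exact: brownianB_integrable.
have [r intB] : exists r, (\int[P]_(w in A) (B v w - B u w)%:E = r%:E)%E.
  exists (fine (\int[P]_(w in A) (B v w - B u w)%:E)).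
  by rewrite fineK//; exact: integrable_fin_num.
have [p PA] : exists p, P A = p%:E.
  by exists (fine (P A)); rewrite fineK// fin_num_measure.
have p0 : 0 <= p by rewrite -lee_fin -PA measure_ge0.
have p1 : p <= 1 by rewrite -lee_fin -PA; exact: probability_le1.
(* As exp (th x) >= 1 + th x, the exponential moment bounds th * r from above by
   O(th^2) for th of either sign, which forces r = 0. *)
have ineq th : p + th * r <= p * expR (th ^+ 2 * (v - u) / 2).
  have := @expectation_expR_brownianB u v th \1_A u0 uv
    (sub_measurable_indic (filtration_sigma usual_F u0) FuA) (fun=> ler0n _ _).
  rewrite integral_indic//= setIT PA -EFinM => E.
  rewrite -lee_fin -E.
  have -> : (p + th * r)%:E =
      (\int[P]_(w in A) (1 + th * (B v w - B u w))%:E)%E.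
    under eq_integral do rewrite EFinD EFinM.
    rewrite integralD//; last 2 first.
    - exact: finite_measure_integrable_cst.
    - exact: integrableZl.
    by rewrite integral_cst//= mul1e PA integralZl// intB EFinD EFinM.
  have -> : (\int[P]_w (\1_A w * expR (th * (B v w - B u w)))%:E =
      \int[P]_(w in A) (expR (th * (B v w - B u w)))%:E)%E.
    rewrite [RHS]integral_mkcond; apply: eq_integral => w _.
    by rewrite patchE indicE; case: (w \in A); rewrite ?mul1r ?mul0r.
  apply: le_integral => //.
  - under eq_fun do rewrite EFinD EFinM.
    apply: integrableD => //; first exact: finite_measure_integrable_cst.
    exact: integrableZl.
  - apply: (integrableS measurableT) => //.
    exact: expR_brownianB_integrable.
  - by move=> w _; rewrite lee_fin expR_ge1Dx.
rewrite intB; congr EFin; apply/eqP; rewrite -[_ == _]negbK; apply/negP => r0.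
set K := (v - u) / 2; have K0 : 0 <= K by rewrite divr_ge0// subr_ge0.
have r20 : 0 < r ^+ 2 by rewrite exprn_even_gt0.
have rK : 0 <= r ^+ 2 * K by rewrite mulr_ge0// ltW.
(* The inequality is used at th = e r, with e = 1 / D. The gain th r = e r^2 is of first order in e,
   while the exponent x = e^2 r^2 K is of second order. The choice of D gives e K < 1/4, so that the
   gain wins, and x < 1/2, so that exp x <= 1 + 2 x. *)
pose D := 1 + 4 * K + 2 * (r ^+ 2 * K).
have D1 : 1 <= D by rewrite /D; lra.
have D0 : 0 < D by lra.
set e := D^-1.
have e0 : 0 < e by rewrite invr_gt0.
have e1 : e <= 1 by rewrite invf_le1.
have eD : e * D = 1 by rewrite mulVf ?gt_eqF.
set x := (e * r) ^+ 2 * K.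
have x0 : 0 <= x by rewrite mulr_ge0// sqr_ge0.
have xe : x = e * (e * (r ^+ 2 * K)) by rewrite /x; ring.
have eK : 0 <= e * K by rewrite mulr_ge0// ltW.
have erK : 0 <= e * (r ^+ 2 * K) by rewrite mulr_ge0// ltW.
have ee : e + 4 * (e * K) + 2 * (e * (r ^+ 2 * K)) = 1.
  by rewrite -[RHS]eD /D; ring.
have x2 : 2 * x <= e * (r ^+ 2 * K) * 2.
  rewrite xe mulrC ler_pM2r// ler_piMl//.
have expx : expR x <= 1 + 2 * x.
  have := expR_ge1Dx (- x); rewrite expRN.
  rewrite -lef_pV2 ?posrE ?invr_gt0 ?expR_gt0//; last by lra.
  rewrite invrK => /le_trans; apply.
  rewrite invf_ple ?posrE; [|lra|lra].
  by rewrite -[leLHS]div1r ler_pdivrMr; nra.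
have i1 : p + e * r * r <= p * expR x 
  by have := ineq (e * r); rewrite -[_ ^+ 2 * _ / _]mulrA.
have i2 : e * r * r <= p * (2 * x).
  have : p * expR x <= p * (1 + 2 * x) by rewrite ler_wpM2l.
  by move: (expR x) i1 => ex i1 i4; lra.
have i3 : e * r * r <= 2 * x.
  by rewrite (le_trans i2)// ler_piMl// mulr_ge0.
have : e * r ^+ 2 * (1 - 2 * (e * K)) <= 0.
  suff -> : e * r ^+ 2 * (1 - 2 * (e * K)) = e * r * r - 2 * x.
    by rewrite subr_le0.
  by rewrite xe; ring.
have : 0 < 1 - 2 * (e * K) by lra.
by move=> h; rewrite leNgt mulr_gt0// mulr_gt0.
Qed.

End brownian.

(** * Continuous integrands and the quadratic variation *)

Section continuous_half_line.
Context {R : realType}.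
Local Notation leb := (@lebesgue_measure R).
Implicit Types (g : R -> R) (a b : R).

Lemma continuous_half_line_itv g a b : {within `[0, +oo[, continuous g} ->
  0 <= a -> {within `[a, b], continuous g}.
Proof.
move=> cg a0; apply: (continuous_subspaceW _ cg) => x /=.
by rewrite !in_itv/= andbT => /andP[/(le_trans a0)].
Qed.

Lemma continuous_itv_integrable g a b :
  {within `[a, b], continuous g} -> leb.-integrable `[a, b] (EFin \o g).
Proof.
by move=> cg; apply: continuous_compact_integrable => //; exact: segment_compact.
Qed.

Lemma within_continuous_epsdelta g (A : set R) : {within A, continuous g} <->
  forall x, A x -> forall e : R, 0 < e ->
  exists2 r : R, 0 < r & forall y, A y -> `|x - y| < r -> `|g x - g y| < e.
Proof.
split=> [/subspace_continuousP cg x Ax e e0|cg].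
  have /cvgrPdist_lt/(_ e e0) := cg x Ax.
  rewrite near_withinE => /nbhs_ballP[r /= r0 H].
  by exists r => // y Ay xy; exact: H.
apply/subspace_continuousP => x Ax; apply/cvgrPdist_lt => e e0.
have [r r0 H] := cg x Ax e e0.
by rewrite near_withinE; apply/nbhs_ballP; exists r => // y xy Ay; exact: H.
Qed.

Lemma within_continuous_compR g (h : R -> R) (A : set R) :
  {within A, continuous g} -> (forall x, A x -> {for g x, continuous h}) ->
  {within A, continuous (fun x => h (g x))}.
Proof.
move=> /subspace_continuousP cg ch; apply/subspace_continuousP => x Ax.
by apply: (continuous_cvg _ (ch x Ax)); exact: cg.
Qed.

(** Heine-Cantor. Compactness is used as a near-covering property: a radius that works around each
    point becomes one radius for the whole interval. *)
Lemma continuous_itv_uniform g a b (e : R) :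
  {within `[a, b], continuous g} -> 0 < e ->
  exists2 r, 0 < r & forall x y, x \in `[a, b] -> y \in `[a, b] ->
    `|x - y| < r -> `|g x - g y| < e.
Proof.
move=> /within_continuous_epsdelta cg e0.
pose Q (r : R) (x : R) :=
  forall y, y \in `[a, b] -> `|x - y| < r -> `|g x - g y| < e.
have /compact_near_coveringP/near_covering_withinP := @segment_compact R a b.
move=> /(_ R (0^'+) Q _) near_cov.
have : \forall r \near 0^'+, `[a, b] `<=` Q r.
  apply: near_cov => x xab.
  have e20 : 0 < e / 2 by rewrite divr_gt0.
  have [r r0 H] := cg x xab (e / 2) e20.
  have r20 : 0 < r / 2 by rewrite divr_gt0.
  exists (ball x (r / 2), [set s | s < r / 2]) => /=.
    by split; [exact: nbhsx_ballx|exact: nbhs_right_lt].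
  move=> [y s] [/= xy sr] yab z zab yz.
  have xyr : `|x - y| < r by rewrite (lt_trans xy)// gtr_pMr// invf_lt1// ltr1n.
  have xzr : `|x - z| < r.
    by rewrite (le_lt_trans (ler_distD y _ _))// [ltRHS]splitr ltrD// (lt_trans yz).
  rewrite (le_lt_trans (ler_distD (g x) _ _))// [ltRHS]splitr ltrD//.
    by rewrite distrC; exact: H.
  exact: H.
move=> nr; near (0 : R)^'+ => r.
exists r => // x y xab yab xy.
by have : `[a, b] `<=` Q r; [near: r|exact].
Unshelve. all: end_near. Qed.

(** The coefficient on a piece is the value of g where g^2 is minimal. Uniform continuity makes it
    close to g, and minimality bounds its square by g^2 exactly, which spares an error term in the
    exponential moments. *)
Lemma step_partition g a b (e : R) : {within `[a, b], continuous g} ->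
  a <= b -> 0 < e -> exists (n : nat) (x c : nat -> R),
  [/\ x 0%N = a, x n = b, nondecreasing_seq x &
     forall i s, (i < n)%N -> x i < s <= x i.+1 ->
       `|g s - c i| <= e /\ c i ^+ 2 <= g s ^+ 2].
Proof.
move=> cg ab e0; have [r r0 gr] := continuous_itv_uniform cg e0.
pose n := (Num.truncn ((b - a) / r)).+1.
have nr : (b - a) / n%:R < r.
  rewrite ltr_pdivrMr// mulrC -ltr_pdivrMr//.
  have : 0 <= (b - a) / r by rewrite divr_ge0 ?subr_ge0// ltW.
  by move=> /truncn_itv/andP[].
pose x i := a + i%:R * ((b - a) / n%:R).
have d0 : 0 <= (b - a) / n%:R by rewrite divr_ge0// subr_ge0.
have x0 : x 0%N = a by rewrite /x mul0r addr0.
have xn : x n = b by rewrite /x mulrC divfK ?pnatr_eq0// subrKC.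
have ndx : nondecreasing_seq x.
  by move=> i j ij; rewrite /x lerD2l ler_wpM2r// ler_nat.
have xab i : (i <= n)%N -> a <= x i <= b.
  move=> ni; have := ndx _ _ ni; have := ndx _ _ (leq0n i).
  by rewrite x0 xn => -> ->.
have sub i : (i < n)%N -> `[x i, x i.+1] `<=` `[a, b].
  move=> ni s /=; rewrite !in_itv/= => /andP[xs sx].
  have /andP[a1 _] := xab i (ltnW ni); have /andP[_ b1] := xab i.+1 ni.
  by rewrite (le_trans a1 xs) (le_trans sx b1).
have /choice[c cP] : forall i, exists ci, (i < n)%N -> forall s, x i < s <= x i.+1 ->
       `|g s - ci| <= e /\ ci ^+ 2 <= g s ^+ 2.
  move=> i; have [ni|] := ltnP i n; last by exists 0.
  have cgi : {within `[x i, x i.+1], continuous (fun s => g s ^+ 2)}.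
    have := continuous_subspaceW (sub i ni) cg.
    move=> cx; apply: (within_continuous_compR (h := fun z => z ^+ 2) cx) => ? _.
    exact: exprn_continuous.
  have [u ui umin] := EVT_min (ndx _ _ (leqnSn i)) cgi.
  exists (g u) => _ s /andP[xs sx].
  have si : s \in `[x i, x i.+1] by rewrite in_itv/= (ltW xs).
  split; last exact: umin.
  apply/ltW/gr; [exact: sub si|exact: sub ui|].
  apply: le_lt_trans nr.
  have xS : x i.+1 = x i + (b - a) / n%:R by rewrite /x -natr1; ring.
  move: si ui; rewrite !in_itv/= xS => /andP[? ?] /andP[? ?].
  by rewrite ler_norml; lra.
exists n, x, c; split => // i s ni; exact: cP.
Qed.

End continuous_half_line.

Section quad_var.
Context {R : realType} {sigma : R -> R}.
Hypothesis csigma : {within `[0, +oo[, continuous sigma}.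
Local Notation leb := (@lebesgue_measure R).
Implicit Types (u v t : R).

Lemma continuous_sqr_sigma : {within `[0, +oo[, continuous (fun s => sigma s ^+ 2)}.
Proof.
apply: (within_continuous_compR (h := fun z => z ^+ 2) csigma) => ? _.
exact: exprn_continuous.
Qed.

Lemma integrable_sqr_sigma u v : 0 <= u ->
  leb.-integrable `[u, v] (fun s => (sigma s ^+ 2)%:E).
Proof.
move=> u0; apply: continuous_itv_integrable.
exact: continuous_half_line_itv continuous_sqr_sigma u0.
Qed.

Lemma quad_varB u v : 0 <= u -> u <= v ->
  quad_var sigma v - quad_var sigma u =
  \int[leb]_(s in `]u, v]) sigma s ^+ 2.
Proof.
move=> u0 uv; rewrite /quad_var Rintegral_itvB ?bnd_simp//.
exact: integrable_sqr_sigma.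
Qed.

Lemma quad_var_ge0 t : 0 <= quad_var sigma t.
Proof. by apply: Rintegral_ge0 => s _; exact: sqr_ge0. Qed.

(** With k = 0 this is monotonicity; with k the square of a step coefficient it compares the
    variance of one step with the increment of [quad_var]. *)
Lemma quad_varB_ge u v k : 0 <= u -> u <= v ->
  (forall s, u < s <= v -> k <= sigma s ^+ 2) ->
  k * (v - u) <= quad_var sigma v - quad_var sigma u.
Proof.
move=> u0 uv ks; rewrite quad_varB//.
have -> : k * (v - u) = \int[leb]_(s in `]u, v]) k.
  rewrite Rintegral_cst//= lebesgue_measure_itv/= lte_fin.
  move: uv; rewrite le_eqVlt => /predU1P[->|->//].
  by rewrite ltxx subrr.
apply: le_Rintegral => //.
- apply: measurable_bounded_integrable => //=.
    by rewrite lebesgue_measure_itv/=; case: ifP => //; rewrite ltry.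
  by exists `|k|; split => // M kM s _; exact: ltW.
- apply: (integrableS _ _ _ (integrable_sqr_sigma v u0)) => //.
  by apply: subset_itvr; rewrite bnd_simp.
Qed.

Lemma quad_var_nd u v : 0 <= u -> u <= v -> quad_var sigma u <= quad_var sigma v.
Proof.
move=> u0 uv; have := @quad_varB_ge u v 0 u0 uv (fun s _ => sqr_ge0 _).
by rewrite mul0r subr_ge0.
Qed.

Lemma quad_var0 : quad_var sigma 0 = 0.
Proof. by rewrite /quad_var set_itv1 Rintegral_set1. Qed.

Lemma quad_var_continuous : {within `[0, +oo[, continuous (quad_var sigma)}.
Proof.
apply/within_continuous_epsdelta => x /=; rewrite in_itv/= andbT => x0 e e0.
have x10 : 0 <= x + 1 by rewrite addr_ge0.
have := parameterized_integral_continuous x10 (integrable_sqr_sigma (x + 1) (lexx _)).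
have x01 : `[0, x + 1]%classic x by rewrite /= in_itv/= x0 lerDl ler01.
move=> /within_continuous_epsdelta/(_ x x01 e e0)[r r0 H].
(* The radius 1 keeps y inside [0, x + 1], where the continuity of the parametrised integral is
   known. *)
exists (Num.min r 1); first by rewrite lt_min r0 ltr01.
move=> y /=; rewrite in_itv/= andbT => y0; rewrite lt_min => /andP[xyr xy1].
apply: H => //=; rewrite in_itv/= y0/= ltW// -ltrBlDl.
by rewrite (le_lt_trans (ler_norm _))// distrC.
Qed.

Lemma measurable_sqr_sigma :
  measurable_fun (`]0, +oo[ : set R) (fun s => (sigma s ^+ 2)%:E).
Proof.
apply/measurable_EFinP.
have : measurable_fun (`[0, +oo[ : set R) (fun s => sigma s ^+ 2).
  exact: subspace_continuous_measurable_fun continuous_sqr_sigma.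
by apply: measurable_funS => //; apply: subset_itvr; rewrite bnd_simp.
Qed.

(** A nondecreasing function that does not diverge is bounded; monotone convergence along the
    intervals ]0, n] would then make sigma^2 integrable. *)
Lemma quad_var_pinfty :
  ~ leb.-integrable `]0, +oo[ (fun s : R => (sigma s ^+ 2)%:E) ->
  quad_var sigma t @[t --> +oo] --> +oo.
Proof.
move=> nint; apply/cvgryPge => A.
have [[t0 t00 At0]|] := pselect (exists2 t, 0 <= t & A <= quad_var sigma t).
  apply: filterS (nbhs_pinfty_ge (num_real t0)) => t t0t.
  by rewrite (le_trans At0)// quad_var_nd.
move=> nA; exfalso; apply: nint.
apply/integrableP; split; first exact: measurable_sqr_sigma.
under eq_integral do rewrite gee0_abs ?lee_fin ?sqr_ge0//.
apply: (@le_lt_trans _ _ A%:E); last exact: ltry.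
pose D (n : nat) := `]0, (n%:R : R)]%classic.
have UD : \bigcup_n D n = `]0, +oo[%classic.
  apply/seteqP; split=> [x [n _]|x]; rewrite /D/= !in_itv/= ?andbT.
    by case/andP.
  move=> x0; exists (Num.truncn x).+1 => //=; rewrite in_itv/= x0/=.
  by have /truncn_itv/andP[_ /ltW] := ltW x0.
rewrite -UD.
have {}cvgD : (\int[leb]_(s in D n) (sigma s ^+ 2)%:E @[n --> \oo] -->
    \int[leb]_(s in \bigcup_n D n) (sigma s ^+ 2)%:E)%E.
  apply: ge0_nondecreasing_set_cvg_integral.
  - apply/nondecreasing_seqP => n; rewrite subsetEset; apply: subset_itvl.
    by rewrite bnd_simp ler_nat.
  - by move=> n; exact: measurable_itv.
  - move=> n; apply: measurable_funS measurable_sqr_sigma => //.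
    by apply: subset_itvl; rewrite bnd_simp.
  - by move=> n s _; rewrite lee_fin sqr_ge0.
rewrite -(cvg_lim _ cvgD)//; apply: lime_le.
  by apply/cvg_ex; eexists; exact: cvgD.
apply: nearW => n.
have n0 : 0 <= (n%:R : R) by [].
rewrite integral_itv_obnd_cbnd; last first.
  apply: measurable_funS measurable_sqr_sigma => //.
  by apply: subset_itvl; rewrite bnd_simp.
rewrite -[leLHS]fineK ?lee_fin.
  by rewrite ltW// ltNge; apply/negP => An; apply: nA; exists n%:R.
apply: integrable_fin_num => //; exact: integrable_sqr_sigma.
Qed.

End quad_var.

(** * Step functions *)

Section step_chain.
Context {R : realType}.
Implicit Types (c x : nat -> R) (n : nat) (h : seq (R * (R * R))).

(** Unlike a general step list, its intervals are consecutive, hence disjoint when x is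
    nondecreasing. The list grows on the right, so that induction on n follows time. *)
Definition step_chain c x n : seq (R * (R * R)) :=
  [seq (c i, (x i, x i.+1)) | i <- iota 0 n].

Lemma step_chainS c x n :
  step_chain c x n.+1 = step_chain c x n ++ [:: (c n, (x n, x n.+1))].
Proof.
have iS : iota 0 n.+1 = iota 0 n ++ [:: n] by rewrite -addn1 iotaD.
by rewrite /step_chain iS map_cat.
Qed.

Lemma step_eval_cat h1 h2 s :
  step_eval (h1 ++ h2) s = step_eval h1 s + step_eval h2 s.
Proof. by rewrite /step_eval big_cat. Qed.

Lemma step_eval1 (a u v s : R) :
  step_eval [:: (a, (u, v))] s = if u < s <= v then a else 0.
Proof.
rewrite /step_eval big_seq1 /= indicE mem_setE in_itv/=.
by case: ifP; rewrite ?mulr1 ?mulr0.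
Qed.

Lemma measurable_step_eval h : measurable_fun [set: R] (step_eval h).
Proof.
by apply: measurable_sum => p; apply: measurable_funM.
Qed.

Lemma step_chain_bounds c x n p : nondecreasing_seq x -> p \in step_chain c x n ->
  [/\ x 0%N <= p.2.1, p.2.1 <= p.2.2 & p.2.2 <= x n].
Proof.
move=> ndx /mapP[i]; rewrite mem_iota add0n => /andP[_ ni] -> /=.
by split; exact: ndx.
Qed.

Lemma step_eval_chain_out c x n s : nondecreasing_seq x ->
  s <= x 0%N \/ x n < s -> step_eval (step_chain c x n) s = 0.
Proof.
move=> ndx; elim: n => [|n IH] ns; first by rewrite /step_eval big_nil.
rewrite step_chainS step_eval_cat step_eval1 IH; last first.
  by case: ns; [left|right; rewrite (le_lt_trans (ndx _ _ (leqnSn n)))].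
rewrite add0r; case: ifPn => // /andP[xs sx]; case: ns.
  by rewrite leNgt (le_lt_trans (ndx _ _ (leq0n n)) xs).
by rewrite ltNge sx.
Qed.

Lemma step_eval_chain_in c x n s i : nondecreasing_seq x ->
  (i < n)%N -> x i < s <= x i.+1 -> step_eval (step_chain c x n) s = c i.
Proof.
move=> ndx; elim: n => // n IH; rewrite ltnS leq_eqVlt => ni xsx.
rewrite step_chainS step_eval_cat step_eval1.
have /andP[xs sx] := xsx.
case/predU1P: ni => [<-|ni].
  by rewrite xsx step_eval_chain_out ?add0r//; right.
rewrite IH// ifF ?addr0//; apply/negbTE; rewrite negb_and -!leNgt.
by apply/orP; left; apply: (le_trans sx); exact: ndx.
Qed.

Lemma step_chain_cover x n s : x 0%N < s <= x n ->
  exists2 i, (i < n)%N & x i < s <= x i.+1.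
Proof.
elim: n => [|n IH] /andP[xs sx]; first by move: xs; rewrite ltNge sx.
have [sn|ns] := leP s (x n).
  by have [|i ni ?] := IH; rewrite ?xs//; exists i => //; rewrite ltnS ltnW.
by exists n => //; rewrite ns.
Qed.

Lemma step_approx (sigma : R -> R) (a b e : R) :
  {within `[0, +oo[, continuous sigma} -> 0 <= a -> a <= b -> 0 < e ->
  exists n x c, [/\ x 0%N = a, x n = b, nondecreasing_seq x,
    (forall i s, (i < n)%N -> x i < s <= x i.+1 -> c i ^+ 2 <= sigma s ^+ 2) &
    (forall s, a < s <= b ->
      `|sigma s - step_eval (step_chain c x n) s| <= e)].
Proof.
move=> csigma a0 ab e0.
have csab := continuous_half_line_itv csigma a0.
have [n [x [c [xa xb ndx H]]]] := step_partition (csab b) ab e0.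
exists n, x, c; split => // [i s ni /(H i s ni)[]//|s].
rewrite -{1}xa -{1}xb => /step_chain_cover[i ni xs].
by rewrite (step_eval_chain_in c ndx ni xs); case: (H i s ni xs).
Qed.

(** A uniform error 1 / (k + 1) gives a squared L^2 error of at most t / (k + 1). *)
Lemma step_approx_cvg (sigma : R -> R) (t : R) (h : nat -> seq (R * (R * R))) :
  {within `[0, +oo[, continuous sigma} -> 0 <= t ->
  (forall k s, 0 < s <= t -> `|sigma s - step_eval (h k) s| <= k.+1%:R^-1) ->
  (\int[lebesgue_measure]_(s in `[0%R, t])
     ((sigma s - step_eval (h k) s) ^+ 2)%:E)%E @[k --> \oo] --> 0%E.
Proof.
move=> csigma t0 H.
have mD k : measurable_fun (`]0, t] : set R)
    (fun s => ((sigma s - step_eval (h k) s) ^+ 2)%:E).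
  apply/measurable_EFinP/measurable_funX/measurable_funB; last first.
    by apply: measurable_funTS; exact: measurable_step_eval.
  have : measurable_fun (`[0, +oo[ : set R) sigma.
    exact: subspace_continuous_measurable_fun.
  by apply: measurable_funS => //; apply: subset_itv; rewrite bnd_simp.
apply: (@squeeze_cvge _ _ _ _ (cst 0%E) _ (fun k => (k.+1%:R^-1 * t)%:E)).
- apply: nearW => k; rewrite integral_ge0/=; last first.
    by move=> s _; rewrite lee_fin sqr_ge0.
  (* The steps live on left-open intervals, so nothing is known at s = 0, which is discarded as a
     null set. *)
  rewrite -integral_itv_obnd_cbnd//.
  apply: (@le_trans _ _ (\int[lebesgue_measure]_(s in `]0%R, t]) (k.+1%:R^-1)%:E)%E).
    apply: ge0_le_integral => //.
    - by move=> s _; rewrite lee_fin sqr_ge0.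
    - exact: mD.
    - move=> s sI; have {sI}Hs : `|sigma s - step_eval (h k) s| <= k.+1%:R^-1.
        by apply: H; move: sI; rewrite /= in_itv.
      rewrite lee_fin -real_normK ?num_real//.
      rewrite (le_trans (_ : _ <= (k.+1%:R^-1) ^+ 2))// ?lerXn2r ?nnegrE//.
      by rewrite expr2 ler_piMl// invf_le1// ler1n.
  rewrite integral_cst//= lebesgue_measure_itv/= lte_fin.
  move: t0; rewrite le_eqVlt => /predU1P[<-|->]; last by rewrite oppr0 adde0.
  by rewrite ltxx mule0 mulr0.
- exact: cvg_cst.
- apply: cvg_EFin; first exact: nearW.
  rewrite -[X in _ --> X](mul0r t); apply: cvgM; last exact: cvg_cst.
  exact: cvg_harmonic.
Qed.

End step_chain.

(** * Ito integrals of deterministic integrands *)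

Section ito.
Context {d : measure_display} {T : measurableType d} {R : realType}.
Context {P : probability T R} {F : R -> set (set T)} {B : R -> T -> R}.
Hypotheses (usual_F : usual_filtration P F) (brownian_B : brownian_motion P F B).
Context {sigma : R -> R} {M : R -> T -> R}.
Hypothesis csigma : {within `[0, +oo[, continuous sigma}.
Hypothesis ito_M : is_ito_process P F B sigma M.
Local Notation q := (quad_var sigma).

Let adapted_M : adapted F M. Proof. by case: ito_M. Qed.
Let adapted_B : adapted F B. Proof. exact: brownian_adapted brownian_B. Qed.

Lemma measurable_ito (t : R) : 0 <= t -> measurable_fun setT (M t).
Proof. exact: (adapted_measurable usual_F). Qed.

Lemma step_integral_cat h1 h2 w :
  step_integral B (h1 ++ h2) w = step_integral B h1 w + step_integral B h2 w.
Proof. by rewrite /step_integral big_cat. Qed.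

Lemma measurable_step_integral (t : R) h : step_on t h ->
  measurable_fun setT (step_integral B h).
Proof.
elim: h => [|p h IH] ht.
  rewrite (_ : step_integral B [::] = cst 0)//.
  by apply/funext => w; rewrite /step_integral big_nil.
have -> : step_integral B (p :: h) =
    (fun w => p.1 * (B p.2.2 w - B p.2.1 w) + step_integral B h w).
  by apply/funext => w; rewrite /step_integral big_cons.
have [p1 p2 p3] := ht p (mem_head _ _).
apply: measurable_funD.
  apply: measurable_funM => //.
  apply: measurable_brownianB usual_F brownian_B _ _ _ _ => //.
  exact: le_trans p2.
by apply: IH => r rh; apply: ht; rewrite inE rh orbT.
Qed.

(** Every increment involved starts at or after s, hence has mean 0 over events of F s.
    Integrability is proved in the same induction because splitting the sum needs it. *)
Lemma integral_step_integral0 (A : set T) (s t : R) h : 0 <= s -> F s A ->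
  (forall p, p \in h -> [/\ s <= p.2.1, p.2.1 <= p.2.2 & p.2.2 <= t]) ->
  P.-integrable setT (EFin \o step_integral B h) /\
  (\int[P]_(w in A) (step_integral B h w)%:E = 0)%E.
Proof.
move=> s0 FA.
have mA : measurable A by exact: (filtration_measurable usual_F s0).
elim: h => [|p h IH] ht.
  rewrite (_ : step_integral B [::] = cst 0); last first.
    by apply/funext => w; rewrite /step_integral big_nil.
  by split; [exact: integrable0|rewrite integral0].
have -> : step_integral B (p :: h) =
    (fun w => p.1 * (B p.2.2 w - B p.2.1 w) + step_integral B h w).
  by apply/funext => w; rewrite /step_integral big_cons.
have [p1 p2 p3] := ht p (mem_head _ _).
have [|ih IHA] := IH; first by move=> r rh; apply: ht; rewrite inE rh orbT.
have iB := brownianB_integrable usual_F brownian_B (le_trans s0 p1) p2.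
have iB' : P.-integrable setT (fun w => (p.1 * (B p.2.2 w - B p.2.1 w))%:E).
  by under eq_fun do rewrite EFinM; exact: integrableZl.
split.
  rewrite (_ : _ \o _ = (fun w => (p.1 * (B p.2.2 w - B p.2.1 w))%:E) \+
    (EFin \o step_integral B h))%E; last by apply/funext.
  exact: integrableD.
under eq_integral do rewrite EFinD.
rewrite integralD//; last 2 first.
- exact: (integrableS measurableT).
- exact: (integrableS measurableT).
rewrite IHA adde0; under eq_integral do rewrite EFinM.
rewrite integralZl//; last exact: (integrableS measurableT).
by rewrite (integral_brownianB0 usual_F brownian_B s0 p1 p2 FA) mule0.
Qed.

(** Measurability at time x n is what separates the past from the next increment in
    [step_chain_mgf]. *)
Lemma sub_measurable_step_chain (c x : nat -> R) n : 0 <= x 0%N ->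
  nondecreasing_seq x ->
  sub_measurable (F (x n)) (step_integral B (step_chain c x n)).
Proof.
move=> x0 ndx; elim: n => [|n IH].
  rewrite (_ : step_integral _ _ = cst 0).
    by apply: sub_measurable_cst; exact: filtration_sigma usual_F _ _.
  by apply/funext => w; rewrite /step_integral big_nil.
have xn0 k : 0 <= x k by rewrite (le_trans x0)//; exact: ndx.
have Fle k : (k <= n.+1)%N -> F (x k) `<=` F (x n.+1).
  by move=> kn; apply: (filtration_le usual_F) => //; exact: ndx.
have algF := filtration_sigma usual_F (xn0 n.+1).
rewrite step_chainS (_ : step_integral B _ =
  step_integral B (step_chain c x n) \+
  ((fun y => c n * y) \o (B (x n.+1) \+ ((fun y => - y) \o B (x n))))).
  apply: (sub_measurableD algF) => //.
    by move=> C mC; apply: (Fle n) => //; exact: IH.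
  apply: (sub_measurable_comp algF (g := fun y => c n * y)).
    exact: measurable_funM.
  apply: (sub_measurableD algF) => //; first exact: adapted_B.
  apply: (sub_measurable_comp algF (g := fun y => - y)).
    exact: oppr_measurable.
  by move=> C mC; apply: (Fle n) => //; exact: adapted_B.
apply/funext => w; rewrite step_integral_cat /=; congr (_ + _).
by rewrite /step_integral big_seq1.
Qed.

(** The last increment is independent of F (x n), so its exponential moment factors out. By the
    bound on c n it is at most exp (th^2 / 2 times the increment of q), and the exponents add up. *)
Lemma step_chain_mgf (c x : nat -> R) n (th : R) :
  0 <= x 0%N -> nondecreasing_seq x ->
  (forall i s, (i < n)%N -> x i < s <= x i.+1 -> c i ^+ 2 <= sigma s ^+ 2) ->
  (\int[P]_w (expR (th * step_integral B (step_chain c x n) w))%:E <=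
   (expR (th ^+ 2 * (q (x n) - q (x 0%N)) / 2))%:E)%E.
Proof.
move=> x0 ndx; have xn0 k : 0 <= x k by rewrite (le_trans x0)//; exact: ndx.
elim: n => [|n IH] cs.
  rewrite subrr mulr0 mul0r expR0.
  under eq_integral do rewrite /step_integral big_nil mulr0 expR0.
  by rewrite integral_cst//= probability_setT mule1.
pose Y w := expR (th * step_integral B (step_chain c x n) w).
have FY : sub_measurable (F (x n)) Y.
  apply: (sub_measurable_comp (filtration_sigma usual_F (xn0 n))
    (g := fun y => expR (th * y))); last exact: sub_measurable_step_chain.
  by apply: measurableT_comp => //; exact: measurable_funM.
have xS : x n <= x n.+1 by exact: ndx.
rewrite (eq_integral (fun w =>
    (Y w * expR (th * c n * (B (x n.+1) w - B (x n) w)))%:E)); last first.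
  move=> w _; rewrite -expRD step_chainS step_integral_cat; congr (expR _)%:E.
  by rewrite /step_integral big_seq1 /= mulrDr mulrA.
rewrite (expectation_expR_brownianB usual_F brownian_B _ (xn0 n) xS FY); last first.
  by move=> w; exact: expR_ge0.
apply: (@le_trans _ _ ((expR (th ^+ 2 * (q (x n) - q (x 0%N)) / 2))%:E *
    (expR ((th * c n) ^+ 2 * (x n.+1 - x n) / 2))%:E)%E).
  apply: lee_wpmul2r; first by rewrite lee_fin expR_ge0.
  by apply: IH => i s ni; apply: cs; rewrite ltnS ltnW.
rewrite -EFinM -expRD lee_fin ler_expR -mulrDl ler_pM2r ?invr_gt0//.
have := quad_varB_ge csigma (xn0 n) xS (fun s => cs n s (ltnSn n)).
move=> /(ler_wpM2l (sqr_ge0 th)) => h.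
by rewrite exprMn; lra.
Qed.

Lemma ito_approx (t : R) : 0 <= t ->
  exists h : nat -> seq (R * (R * R)),
  [/\ forall k, step_on t (h k),
    (\int[P]_w ((M t w - step_integral B (h k) w) ^+ 2)%:E @[k --> \oo] --> 0)%E &
    forall k th, (\int[P]_w (expR (th * step_integral B (h k) w))%:E <=
      (expR (th ^+ 2 * q t / 2))%:E)%E].
Proof.
move=> t0.
have e0 k : 0 < (k.+1%:R^-1 : R) by rewrite invr_gt0 ltr0n.
have /choice[h hP] k := step_approx csigma (lexx 0) t0 (e0 k).
have /choice[x {}hP] := hP; have {hP}/choice[c hP] := hP.
have hon k : step_on t (step_chain (c k) (x k) (h k)).
  have [x0 xn ndx _ _] := hP k.
  by move=> p /(step_chain_bounds ndx); rewrite x0 xn.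
exists (fun k => step_chain (c k) (x k) (h k)); split => //.
- case: ito_M => _ _ /(_ t t0); apply => //.
  by apply: step_approx_cvg => // k s; case: (hP k) => _ _ _ _; exact.
- move=> k th; have [x0 xn ndx cs _] := hP k.
  have := @step_chain_mgf (c k) (x k) (h k) th.
  by rewrite x0 xn quad_var0 subr0; exact.
Qed.

(** L^2 convergence does not carry exponential moments along, so exp (th M) is first truncated at K.
    The limits are taken in the order k to infinity, eta to 0, K to infinity. *)
Lemma ito_mgf (t th : R) : 0 <= t ->
  (\int[P]_w (expR (th * M t w))%:E <= (expR (th ^+ 2 * q t / 2))%:E)%E.
Proof.
move=> t0; have [h [hon hcvg hmgf]] := ito_approx t0.
set C := expR (th ^+ 2 * q t / 2).
have mM := measurable_ito t0.
have mS k := measurable_step_integral (hon k).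
have mexp (Y : T -> R) : measurable_fun setT Y ->
    measurable_fun setT (fun w => expR (th * Y w)).
  by move=> mY; apply: measurableT_comp => //; exact: measurable_funM.
have mmin K : measurable_fun setT (fun w => (Num.min (expR (th * M t w)) K)%:E).
  by apply/measurable_EFinP/measurable_minr => //; exact: mexp.
have min_ge0 K w : 0 <= K -> (0 <= (Num.min (expR (th * M t w)) K)%:E)%E.
  by move=> K0; rewrite lee_fin le_min expR_ge0.
(* on |M t - S| > eta the truncation K is absorbed by (M t - S)^2 / eta^2 *)
have trunc (K eta : R) : 0 <= K -> 0 < eta ->
    (\int[P]_w (Num.min (expR (th * M t w)) K)%:E <=
     (expR (`|th| * eta) * C)%:E)%E.
  move=> K0 eta0.
  set r := K / eta ^+ 2; have r0 : 0 <= r by rewrite divr_ge0// sqr_ge0.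
  pose e k := (\int[P]_w ((M t w - step_integral B (h k) w) ^+ 2)%:E)%E.
  have bound k : (\int[P]_w (Num.min (expR (th * M t w)) K)%:E <=
      (expR (`|th| * eta) * C)%:E + r%:E * e k)%E.
    pose S := step_integral B (h k).
    have mD : measurable_fun setT (fun w => ((M t w - S w) ^+ 2)%:E).
      apply/measurable_EFinP/measurable_funX; apply: measurable_funB => //.
      exact: mS.
    apply: (@le_trans _ _ (\int[P]_w ((expR (`|th| * eta))%:E * (expR (th * S w))%:E +
        r%:E * ((M t w - S w) ^+ 2)%:E))%E).
      apply: ge0_le_integral => //.
      - by move=> w _; exact: min_ge0.
      - apply: emeasurable_funD; apply: measurable_funeM => //.
        by apply/measurable_EFinP; exact: (mexp _ (mS k)).
      - move=> w _; rewrite -!EFinM -EFinD lee_fin.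
        have [Deta|etaD] := leP `|M t w - S w| eta.
          rewrite ge_min; apply/orP; left; rewrite -expRD.
          apply: (@le_trans _ _ (expR (`|th| * eta + th * S w))); last first.
            by rewrite lerDl mulr_ge0// sqr_ge0.
          rewrite ler_expR -lerBlDr -mulrBr (le_trans (ler_norm _))// normrM.
          by rewrite ler_wpM2l.
        rewrite ge_min; apply/orP; right.
        apply: (@le_trans _ _ (r * (M t w - S w) ^+ 2)); last first.
          by rewrite lerDr mulr_ge0// expR_ge0.
        rewrite /r mulrAC ler_pdivlMr ?exprn_gt0// ler_wpM2l//.
        rewrite -[leRHS]real_normK ?num_real// lerXn2r ?nnegrE ?(ltW eta0)//.
        exact: ltW.
    rewrite ge0_integralD//; first last.
    - exact: measurable_funeM.
    - by move=> w _; rewrite mule_ge0 ?lee_fin ?sqr_ge0.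
    - by apply: measurable_funeM; apply/measurable_EFinP; exact: (mexp _ (mS k)).
    rewrite ge0_integralZl//; last first.
      by apply/measurable_EFinP; exact: (mexp _ (mS k)).
    rewrite ge0_integralZl//; last by move=> w _; rewrite lee_fin sqr_ge0.
    apply: leeD => //; rewrite EFinM; apply: lee_wpmul2l => //.
    exact: hmgf.
  have cvgr : ((expR (`|th| * eta) * C)%:E + r%:E * e k @[k --> \oo] -->
      (expR (`|th| * eta) * C)%:E + r%:E * 0)%E.
    apply: cvgeD; [by rewrite mule0|exact: cvg_cst|].
    exact: cvgeZl.
  rewrite mule0 adde0 in cvgr; rewrite -(cvg_lim _ cvgr)//.
  apply: lime_ge; last exact: nearW.
  by apply/cvg_ex; eexists; exact: cvgr.
have {}trunc (K : R) : 0 <= K ->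
    (\int[P]_w (Num.min (expR (th * M t w)) K)%:E <= C%:E)%E.
  move=> K0; set a := integral _ _ _.
  have a0 : (0 <= a)%E by apply: integral_ge0 => w _; exact: min_ge0.
  have afin : a \is a fin_num.
    rewrite ge0_fin_numE// (le_lt_trans (trunc K 1 K0 ltr01))//; exact: ltry.
  rewrite -(fineK afin) lee_fin.
  have := a0; rewrite -(fineK afin) lee_fin le_eqVlt => /predU1P[<-|a_gt0].
    exact: expR_ge0.
  rewrite -ler_ln ?posrE ?expR_gt0//.
  (* The factor exp (|th| eta) is removed on the logarithmic scale, where it costs |th| eta <= eps;
     the 1 added to |th| covers th = 0. *)
  apply/ler_addgt0Pr => eps eps0.
  have th1 : 0 < `|th| + 1 by rewrite ltr_wpDl.
  have := trunc K (eps / (`|th| + 1)) K0 (divr_gt0 eps0 th1).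
  rewrite -/a -(fineK afin) lee_fin -ler_ln ?posrE ?mulr_gt0 ?expR_gt0//.
  move=> /le_trans; apply.
  rewrite lnM ?posrE ?expR_gt0// expRK addrC lerD2l.
  by rewrite mulrA ler_pdivrMr// mulrDr mulr1 mulrC lerDl ltW.
have minE w : (expR (th * M t w))%:E =
    limn (fun n => (Num.min (expR (th * M t w)) n%:R)%:E).
  apply/esym/cvg_lim => //; apply: cvg_near_cst.
  exists (Num.truncn (expR (th * M t w))).+1 => // n /= nn.
  rewrite min_l//; have /truncn_itv/andP[_ /ltW h1] := expR_ge0 (th * M t w).
  by rewrite (le_trans h1)// ler_nat.
under eq_integral do rewrite minE.
rewrite monotone_convergence//.
- apply: lime_le; last by apply: nearW => n; exact: trunc.
  apply: ereal_nondecreasing_is_cvgn => m n mn; apply: ge0_le_integral => //.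
  - by move=> w _; rewrite lee_fin le_min2 ?ler_nat.
- by move=> w _ m n mn; rewrite lee_fin le_min2 ?ler_nat.
Qed.

Lemma ito_expR_integrable (t th : R) : 0 <= t ->
  P.-integrable setT (fun w => (expR (th * M t w))%:E).
Proof.
move=> t0; apply/integrableP; split.
  apply/measurable_EFinP/measurableT_comp => //.
  by apply: measurable_funM => //; exact: measurable_ito.
under eq_integral do rewrite gee0_abs ?lee_fin ?expR_ge0//.
by rewrite (le_lt_trans (ito_mgf th t0))// ltry.
Qed.

Lemma ito_integrable (t : R) : 0 <= t -> P.-integrable setT (EFin \o M t).
Proof.
move=> t0.
have := integrableD measurableT (ito_expR_integrable 1 t0)
  (ito_expR_integrable (-1) t0).
apply: le_integrable => //.
  by apply/measurable_EFinP; exact: measurable_ito.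
move=> w _ /=; rewrite mul1r mulN1r lee_fin.
rewrite [leRHS]ger0_norm ?addr_ge0 ?expR_ge0//.
have := expR_ge1Dx (M t w); have := expR_ge1Dx (- M t w).
have := expR_ge0 (M t w); have := expR_ge0 (- M t w).
by rewrite ler_norml; lra.
Qed.

(** Approximating separately on [0, s] and [s, t] lets the same lists serve M s and M t, so that the
    difference of the two step integrals only involves increments after s. *)
Lemma ito_approx2 (s t : R) : 0 <= s -> s <= t ->
  exists h g : nat -> seq (R * (R * R)),
  [/\ forall k, step_on s (h k),
    forall k p, p \in g k -> [/\ s <= p.2.1, p.2.1 <= p.2.2 & p.2.2 <= t],
    (\int[P]_w ((M s w - step_integral B (h k) w) ^+ 2)%:E @[k --> \oo] --> 0)%E &
    (\int[P]_w ((M t w - step_integral B (h k ++ g k) w) ^+ 2)%:E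
      @[k --> \oo] --> 0)%E].
Proof.
move=> s0 st; have t0 := le_trans s0 st.
have e0 k : 0 < (k.+1%:R^-1 : R) by rewrite invr_gt0 ltr0n.
have /choice[n1 hP] k := step_approx csigma (lexx 0) s0 (e0 k).
have /choice[x1 {}hP] := hP; have {hP}/choice[c1 hP] := hP.
have /choice[n2 gP] k := step_approx csigma s0 st (e0 k).
have /choice[x2 {}gP] := gP; have {gP}/choice[c2 gP] := gP.
pose h k := step_chain (c1 k) (x1 k) (n1 k).
pose g k := step_chain (c2 k) (x2 k) (n2 k).
have hon k : step_on s (h k).
  have [x0 xn ndx _ _] := hP k.
  by move=> p /(step_chain_bounds ndx); rewrite x0 xn.
have gon k p : p \in g k -> [/\ s <= p.2.1, p.2.1 <= p.2.2 & p.2.2 <= t].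
  have [x0 xn ndx _ _] := gP k.
  by move=> /(step_chain_bounds ndx); rewrite x0 xn.
have h0 k u : s < u -> step_eval (h k) u = 0.
  move=> su; have [_ xn ndx _ _] := hP k.
  by apply: step_eval_chain_out => //; right; rewrite xn.
have g0 k u : u <= s -> step_eval (g k) u = 0.
  move=> us; have [x0 _ ndx _ _] := gP k.
  by apply: step_eval_chain_out => //; left; rewrite x0.
exists h, g; split => //; case: ito_M => _ _ itoM.
- apply: (itoM s) => //; apply: step_approx_cvg => // k u.
  by case: (hP k) => _ _ _ _; exact.
- apply: (itoM t) => // [k p|].
    rewrite mem_cat => /orP[/hon[p1 p2 p3]|/gon[p1 p2 p3]]; split => //.
      exact: le_trans st.
    exact: le_trans p1.
  apply: step_approx_cvg => // k u /andP[u0 ut].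
  rewrite step_eval_cat; have [us|su] := leP u s.
    by rewrite (g0 _ _ us) addr0; case: (hP k) => _ _ _ _; apply; rewrite u0.
  by rewrite (h0 _ _ su) add0r; case: (gP k) => _ _ _ _; apply; rewrite su.
Qed.

Lemma ito_incr_integrable (s t : R) : 0 <= s -> s <= t ->
  P.-integrable setT (EFin \o (M t \- M s)).
Proof.
move=> s0 st; rewrite (_ : _ \o _ = (EFin \o M t) \- (EFin \o M s))%E//.
by apply: integrableB => //; apply: ito_integrable => //; exact: le_trans st.
Qed.

(** The step integral over [s, t] has mean 0 over A, so only the approximation errors [X k] and
    [Y k] remain. Their L^1 norm is controlled by their L^2 norms up to an arbitrary eta. *)
Lemma ito_martingale (A : set T) (s t : R) : 0 <= s -> s <= t -> F s A ->
  (\int[P]_(w in A) (M t w - M s w)%:E = 0)%E.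
Proof.
move=> s0 st FA; have t0 := le_trans s0 st.
have mA : measurable A by exact: (filtration_measurable usual_F s0).
have [h [g [hon gon cvgs cvgt]]] := ito_approx2 s0 st.
have hgon k : step_on t (h k ++ g k).
  move=> p; rewrite mem_cat => /orP[/hon[p1 p2 p3]|/gon[p1 p2 p3]]; split => //.
    exact: le_trans st.
  exact: le_trans p1.
pose X k w := M t w - step_integral B (h k ++ g k) w.
pose Y k w := M s w - step_integral B (h k) w.
have mX k : measurable_fun setT (X k).
  apply: measurable_funB; first exact: measurable_ito.
  exact: (measurable_step_integral (hgon k)).
have mY k : measurable_fun setT (Y k).
  apply: measurable_funB; first exact: measurable_ito.
  exact: (measurable_step_integral (hon k)).
pose a := (\int[P]_(w in A) (M t w - M s w)%:E)%E.
have iM : P.-integrable A (EFin \o (M t \- M s)).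
  by apply: (integrableS measurableT) => //; exact: ito_incr_integrable.
have afin : a \is a fin_num by exact: integrable_fin_num.
suff a0 : (`|a| <= 0)%E.
  by apply/eqP; rewrite -abse_eq0 eq_le a0 abse_ge0.
apply/lee_addgt0Pr => eta eta0; rewrite add0e.
pose e k := ((2 / eta)%:E *
  (\int[P]_w ((X k w) ^+ 2)%:E + \int[P]_w ((Y k w) ^+ 2)%:E))%E.
have bound k : (`|a| <= eta%:E + e k)%E.
  have [iS S0] := integral_step_integral0 s0 FA (gon k).
  have iSA : P.-integrable A (EFin \o step_integral B (g k)).
    by apply: (integrableS measurableT).
  have aE : a = (\int[P]_(w in A) (X k w - Y k w)%:E)%E.
    transitivity (\int[P]_(w in A) ((M t w - M s w)%:E -
        (step_integral B (g k) w)%:E))%E.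
      by rewrite integralB// S0 sube0.
    apply: eq_integral => w _; rewrite -EFinB; congr EFin.
    by rewrite /X /Y step_integral_cat; ring.
  have mXY : measurable_fun A (fun w => (X k w - Y k w)%:E).
    by apply: measurable_funTS; apply/measurable_EFinP; exact: measurable_funB.
  rewrite aE (le_trans (le_abse_integral _ mA mXY))//.
  have mX2 : measurable_fun setT (fun w => (X k w ^+ 2)%:E).
    by apply/measurable_EFinP; exact: measurable_funX.
  have mY2 : measurable_fun setT (fun w => (Y k w ^+ 2)%:E).
    by apply/measurable_EFinP; exact: measurable_funX.
  apply: (@le_trans _ _ (\int[P]_w `|(X k w - Y k w)%:E|)%E).
    apply: ge0_subset_integral => //.
    by apply: measurableT_comp => //; apply/measurable_EFinP; exact: measurable_funB.
  have eta20 : (0 <= (2 / eta)%:E)%E by rewrite lee_fin divr_ge0// ltW.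
  apply: (@le_trans _ _ (\int[P]_w (eta%:E + (2 / eta)%:E *
      ((X k w ^+ 2)%:E + (Y k w ^+ 2)%:E)))%E).
    apply: ge0_le_integral => //.
    - by apply: measurableT_comp => //; apply/measurable_EFinP; exact: measurable_funB.
    - apply: emeasurable_funD => //; apply: measurable_funeM.
      exact: emeasurable_funD.
    - move=> w _; rewrite -!(EFinM, EFinD) lee_fin.
      set u := X k w - Y k w.
      (* |u| <= eta + u^2 / eta and (x - y)^2 <= 2 x^2 + 2 y^2 *)
      have h1 : `|u| * eta <= eta ^+ 2 + u ^+ 2.
        have := sqr_ge0 (`|u| - eta / 2); have := sqr_ge0 eta.
        by rewrite -[u ^+ 2]real_normK ?num_real//; nra.
      have h2 : u ^+ 2 <= 2 * (X k w ^+ 2 + Y k w ^+ 2).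
        by have := sqr_ge0 (X k w + Y k w); rewrite /u; nra.
      rewrite -(ler_pM2r eta0) mulrDl -expr2 (le_trans h1)// lerD2l.
      by rewrite mulrAC divfK ?gt_eqF.
  rewrite ge0_integralD//; first last.
  - by apply: measurable_funeM; exact: emeasurable_funD.
  - by move=> w _; rewrite mule_ge0// adde_ge0// lee_fin sqr_ge0.
  - by move=> w _; rewrite lee_fin ltW.
  rewrite integral_cst//= probability_setT mule1 leeD2l//.
  rewrite ge0_integralZl//; last 2 first.
  - exact: emeasurable_funD.
  - by move=> w _; rewrite adde_ge0// lee_fin sqr_ge0.
  rewrite ge0_integralD//.
  - by move=> w _; rewrite lee_fin sqr_ge0.
  - by move=> w _; rewrite lee_fin sqr_ge0.
have cvgr : (eta%:E + e k @[k --> \oo] --> eta%:E + (2 / eta)%:E * (0 + 0))%E.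
  apply: cvgeD; [by rewrite adde0 mule0|exact: cvg_cst|].
  by apply: cvgeZl => //; apply: cvgeD.
rewrite adde0 mule0 adde0 in cvgr; rewrite -(cvg_lim _ cvgr)//.
apply: lime_ge; last exact: nearW.
by apply/cvg_ex; eexists; exact: cvgr.
Qed.

End ito.

(** * Maximal inequality *)

Section maximal_inequality.
Context {d : measure_display} {T : measurableType d} {R : realType}.
Context {P : probability T R} {F : R -> set (set T)} {N : R -> T -> R}.
Hypotheses (usual_F : usual_filtration P F) (adapted_N : adapted F N).
Hypothesis integrable_N : forall s t, 0 <= s -> s <= t ->
  P.-integrable setT (EFin \o (N t \- N s)).
Hypothesis martingale_N : forall A s t, 0 <= s -> s <= t -> F s A ->
  (\int[P]_(w in A) (N t w - N s w)%:E = 0)%E.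
Context {t th C lam : R}.
Hypotheses (th0 : 0 <= th) (mgf_N : (\int[P]_w (expR (th * N t w))%:E <= C%:E)%E).

Let mN (s : R) : 0 <= s -> measurable_fun setT (N s).
Proof. exact: (adapted_measurable usual_F). Qed.

(** Indices stay strictly below n, so that first passage at step n is the event lam < N (x n) minus
    [exceed x n], and belongs to F (x n). *)
Definition exceed (x : nat -> R) (n : nat) : set T :=
  [set w | exists2 i, (i < n)%N & lam < N (x i) w].

Lemma exceedS x n : exceed x n.+1 = exceed x n `|` [set w | lam < N (x n) w].
Proof.
apply/seteqP; split=> [w [i]|w [[i ni Ni]|Nn]].
- by rewrite ltnS leq_eqVlt => /predU1P[->|ni] Ni; [right|left; exists i].
- by exists i => //; rewrite ltnS ltnW.
- by exists n.
Qed.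

Lemma exceed_filtration x n : 0 <= x 0%N -> nondecreasing_seq x ->
  F (x n) (exceed x n).
Proof.
move=> x0 ndx; have xn0 k : 0 <= x k by rewrite (le_trans x0)//; exact: ndx.
elim: n => [|n IH].
  rewrite (_ : exceed x 0 = set0); last first.
    by rewrite -subset0 => w [].
  by have [] := filtration_sigma usual_F (xn0 0%N).
have Fle : F (x n) `<=` F (x n.+1).
  by apply: (filtration_le usual_F) => //; exact: ndx.
apply: Fle; rewrite exceedS.
apply: (sigma_algebra_setU (filtration_sigma usual_F (xn0 n))) => //.
have := adapted_N (xn0 n) (C := `]lam, +oo[%classic).
rewrite (_ : _ @^-1` _ = [set w | lam < N (x n) w]).
  by apply; exact: measurable_itv.
by apply/seteqP; split=> w /=; rewrite in_itv/= andbT.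
Qed.

(** Doob's argument, summed over the disjoint first-passage events A. On A the tangent inequality
    and N (x n) > lam give exp (th N t) >= exp (th lam) (1 + th (N t - N (x n))), and the increment
    has mean 0 over A. *)
Lemma exceed_bound x n : 0 <= x 0%N -> nondecreasing_seq x -> 0 <= t ->
  (forall i, (i < n)%N -> x i <= t) ->
  ((expR (th * lam))%:E * P (exceed x n) <=
   \int[P]_(w in exceed x n) (expR (th * N t w))%:E)%E.
Proof.
move=> x0 ndx t0; have xn0 k : 0 <= x k by rewrite (le_trans x0)//; exact: ndx.
have mexp : measurable_fun setT (fun w => (expR (th * N t w))%:E).
  apply/measurable_EFinP/measurableT_comp => //.
  by apply: measurable_funM => //; exact: mN.
elim: n => [|n IH] xt.
  rewrite (_ : exceed x 0 = set0); last by rewrite -subset0 => w [].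
  by rewrite measure0 mule0 integral_set0.
have {}IH := IH (fun i ni => xt i (ltnW ni)).
have FU := exceed_filtration n x0 ndx.
have FV : F (x n) [set w | lam < N (x n) w].
  have := adapted_N (xn0 n) (C := `]lam, +oo[%classic).
  rewrite (_ : _ @^-1` _ = [set w | lam < N (x n) w]).
    by apply; exact: measurable_itv.
  by apply/seteqP; split=> w /=; rewrite in_itv/= andbT.
pose A := [set w | lam < N (x n) w] `\` exceed x n.
have FA : F (x n) A.
  exact: (sigma_algebra_setD (filtration_sigma usual_F (xn0 n))).
have mU : measurable (exceed x n) by exact: (filtration_measurable usual_F (xn0 n)).
have mA : measurable A by exact: (filtration_measurable usual_F (xn0 n)).
have UA : exceed x n.+1 = exceed x n `|` A.
  by rewrite exceedS /A setDE setUIr setUCr setIT.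
have dUA : [disjoint exceed x n & A].
  by rewrite disj_set2E /A setDE setICA setICr setI0.
have xnt : x n <= t by exact: xt.
rewrite UA measureU//; last exact/eqP.
rewrite ge0_integral_setU//; last exact: measurable_funTS.
rewrite ge0_muleDr// leeD//.
have iN : P.-integrable A (EFin \o (N t \- N (x n))).
  by apply: (integrableS measurableT) => //; exact: integrable_N.
have iN' : P.-integrable A (fun w => (1 + th * (N t w - N (x n) w))%:E).
  under eq_fun do rewrite EFinD EFinM.
  apply: integrableD => //; first exact: finite_measure_integrable_cst.
  exact: integrableZl.
have -> : ((expR (th * lam))%:E * P A = \int[P]_(w in A)
    ((expR (th * lam))%:E * (1 + th * (N t w - N (x n) w))%:E))%E.
  rewrite integralZl//; congr (_ * _)%E.
  under eq_integral do rewrite EFinD EFinM.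
  rewrite integralD//; last 2 first.
  - exact: finite_measure_integrable_cst.
  - exact: integrableZl.
  by rewrite integral_cst//= mul1e integralZl// martingale_N// mule0 adde0.
apply: le_integral => //.
- exact: integrableZl.
- apply: (integrableS measurableT) => //; apply/integrableP; split => //.
  under eq_integral do rewrite gee0_abs ?lee_fin ?expR_ge0//.
  by rewrite (le_lt_trans mgf_N)// ltry.
- move=> w; rewrite inE => -[/= lamN _]; rewrite -EFinM lee_fin.
  have -> : expR (th * N t w) = expR (th * lam) * expR (th * (N t w - lam)).
    by rewrite -expRD; congr expR; ring.
  rewrite ler_pM2l ?expR_gt0// (le_trans _ (expR_ge1Dx _))//.
  by rewrite lerD2l ler_wpM2l// lerD2l lerN2 ltW.
Qed.

Lemma exceed_prob x n : 0 <= x 0%N -> nondecreasing_seq x -> 0 <= t ->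
  (forall i, (i < n)%N -> x i <= t) ->
  (P (exceed x n) <= (expR (- (th * lam)) * C)%:E)%E.
Proof.
move=> x0 ndx t0 xt; have xn0 k : 0 <= x k by rewrite (le_trans x0)//; exact: ndx.
have mU : measurable (exceed x n).
  exact: (filtration_measurable usual_F (xn0 n)) (exceed_filtration n x0 ndx).
have := exceed_bound x0 ndx t0 xt.
move=> /(lee_wpmul2l (_ : 0 <= (expR (- (th * lam)))%:E)%E).
rewrite muleA -EFinM -expRD addNr expR0 mul1e.
move=> /(_ _)/le_trans; apply; first by rewrite lee_fin expR_ge0.
rewrite EFinM lee_wpmul2l ?lee_fin ?expR_ge0// (le_trans _ mgf_N)//.
apply: ge0_subset_integral => //.
apply/measurable_EFinP/measurableT_comp => //.
by apply: measurable_funM => //; exact: mN.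
Qed.

Definition dyadic_time (m i : nat) : R := t * i%:R / 2 ^+ m.

(** Dyadic grids are nested, so the passage events increase and their bound passes to the union; a
    continuous path above lam at some time is above it at a nearby dyadic time. Asking only for a
    measurable E that contains the passages avoids the measurability of an uncountable supremum. *)
Lemma martingale_maximal_inequality : 0 < t -> exists2 E : set T,
  measurable E /\ (P E <= (expR (- (th * lam)) * C)%:E)%E &
  forall w, {within `[0, +oo[, continuous (N ^~ w)} ->
    forall s, 0 <= s <= t -> lam < N s w -> E w.
Proof.
move=> t_gt0; have t0 := ltW t_gt0.
have p0 m : 0 < (2 ^+ m : R) by rewrite exprn_gt0.
have ndx m : nondecreasing_seq (dyadic_time m).
  move=> i j ij; rewrite /dyadic_time ler_wpM2r ?invr_ge0 ?(ltW (p0 _))//.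
  by rewrite ler_wpM2l// ler_nat.
have x0 m : 0 <= dyadic_time m 0 by rewrite /dyadic_time mulr0 mul0r.
have xt m i : (i < (2 ^ m).+1)%N -> dyadic_time m i <= t.
  rewrite ltnS => im; rewrite /dyadic_time ler_pdivrMr// ler_wpM2l//.
  by rewrite -natrX ler_nat.
pose V m := exceed (dyadic_time m) (2 ^ m).+1.
have mV m : measurable (V m).
  have xn0 : 0 <= dyadic_time m (2 ^ m).+1 by rewrite (le_trans (x0 m))//; exact: ndx.
  exact: (filtration_measurable usual_F xn0) (exceed_filtration _ (x0 m) (ndx m)).
have ndV : nondecreasing_seq V.
  apply/nondecreasing_seqP => m; rewrite subsetEset => w [i im Ni].
  exists i.*2; first by rewrite ltnS expnS mul2n leq_double -ltnS.
  suff -> : dyadic_time m.+1 i.*2 = dyadic_time m i by [].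
  rewrite /dyadic_time exprS -muln2 natrM; field.
  by rewrite gt_eqF.
have mUV : measurable (\bigcup_m V m) by exact: bigcup_measurable.
exists (\bigcup_m V m).
  split => //.
  have := nondecreasing_cvg_mu mV mUV ndV => /(_ _ P) cvgV.
  rewrite -(cvg_lim _ cvgV)//; apply: lime_le.
    by apply/cvg_ex; eexists; exact: cvgV.
  by apply: nearW => m; exact: (exceed_prob (x0 m) (ndx m) t0 (@xt m)).
move=> w /within_continuous_epsdelta cw s /andP[s0 st] lamN.
have sI : `[0, +oo[%classic s by rewrite /= in_itv/= s0.
have [r r0 H] := cw s sI (N s w - lam) (ltac:(by rewrite subr_gt0)).
have [m tm] : exists m : nat, t / 2 ^+ m < r.
  pose k := Num.truncn (t / r); exists k.+1.
  rewrite ltr_pdivrMr// mulrC -ltr_pdivrMr//.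
  have /truncn_itv/andP[_ h1] : 0 <= t / r by rewrite divr_ge0// ltW.
  rewrite (lt_le_trans h1)// -natrX ler_nat.
  exact/ltnW/ltn_expl.
have h0 : 0 <= s * 2 ^+ m / t by rewrite divr_ge0// mulr_ge0// ltW.
pose i := Num.truncn (s * 2 ^+ m / t).
have /andP[i1 i2] : i%:R <= s * 2 ^+ m / t < i.+1%:R by exact: truncn_itv.
have is1 : dyadic_time m i <= s.
  by rewrite /dyadic_time ler_pdivrMr// mulrC -ler_pdivlMr.
have is2 : s < dyadic_time m i + t / 2 ^+ m.
  rewrite /dyadic_time -mulrDl -[X in _ + X]mulr1 -mulrDr natr1.
  by rewrite ltr_pdivlMr// mulrC [ltRHS]mulrC -ltr_pdivrMr// mulrC.
exists m => //; exists i.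
  rewrite ltnS -(ler_nat R) (le_trans i1)// ler_pdivrMr// natrX.
  by rewrite mulrC ler_wpM2l// ltW.
have : `|N s w - N (dyadic_time m i) w| < N s w - lam.
  apply: H; first by rewrite /= in_itv/= andbT (le_trans (x0 m))//; exact: ndx.
  by rewrite ger0_norm ?subr_ge0//; lra.
by move=> /(le_lt_trans (ler_norm _)); lra.
Qed.

End maximal_inequality.

(** * Upper half of the law of the iterated logarithm *)

Section lil.
Context {R : realType}.

(** The terms are (i + 1)^(- kappa). They telescope against [v], that is (i + 1)^(1 - kappa), the
    discrete form of comparison with an integral. *)
Lemma riemann_partial_sum (kappa : R) (n : nat) : 1 < kappa ->
  \sum_(0 <= i < n) expR (- (kappa * ln i.+1%:R)) <= 1 + (kappa - 1)^-1.
Proof.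
move=> k1; pose p := kappa - 1; have p0 : 0 < p by rewrite subr_gt0.
pose v (i : nat) := expR (- (p * ln (i.+1%:R : R))).
suff H m : \sum_(0 <= i < m.+1) expR (- (kappa * ln i.+1%:R)) <=
    1 + (1 - v m) / p.
  case: n => [|n]; first by rewrite big_geq// addr_ge0// invr_ge0 ltW.
  rewrite (le_trans (H n))// lerD2l -[leRHS]mul1r ler_pM2r ?invr_gt0//.
  by rewrite gerBl expR_ge0.
elim: m => [|m IH].
  by rewrite big_nat1 /v ln1 !mulr0 oppr0 expR0 subrr mul0r addr0.
rewrite big_nat_recr//= (le_trans (lerD IH (lexx _)))// -addrA lerD2l.
rewrite -lerBrDl -mulrBl ler_pdivlMr//.
have -> : 1 - v m.+1 - (1 - v m) = v m - v m.+1 by ring.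
(* exp (p (ln (m+2) - ln (m+1))) >= 1 + p / (m+2) *)
have lnm : (m.+2%:R : R)^-1 <= ln (m.+2%:R) - ln (m.+1%:R).
  have := @le_ln1Dx R (- m.+2%:R^-1).
  have m20 : (m.+2%:R : R) != 0 by rewrite pnatr_eq0.
  have -> : 1 + - (m.+2%:R : R)^-1 = m.+1%:R / m.+2%:R.
    apply: (mulIf m20); rewrite divfK// mulrDl mul1r mulNr mulVf//.
    by rewrite -[in LHS]natr1 addrK.
  rewrite ln_div ?posrE ?ltr0n// => h.
  by rewrite -[leRHS]opprB lerNr; apply: h; rewrite ltrN2 invf_lt1 ?ltr1n ?ltr0n.
have -> : v m = v m.+1 * expR (p * (ln m.+2%:R - ln m.+1%:R)).
  by rewrite /v -expRD; congr expR; ring.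
have -> : expR (- (kappa * ln m.+2%:R)) = v m.+1 * (m.+2%:R)^-1.
  have -> : (m.+2%:R : R)^-1 = expR (- ln m.+2%:R).
    by rewrite expRN lnK ?posrE ?ltr0n.
  by rewrite /v -expRD; congr expR; rewrite /p; ring.
rewrite -[X in _ <= _ - X]mulr1 -mulrBr -mulrA ler_pM2l ?expR_gt0//.
rewrite lerBrDl (le_trans _ (expR_ge1Dx _))// lerD2l mulrC.
by rewrite ler_pM2l.
Qed.

Context {sigma : R -> R}.
Local Notation q := (quad_var sigma).
Local Notation S := (Sigma sigma).

Lemma Sigma_le (u v : R) : expR 1 <= q u -> q u <= q v -> S u <= S v.
Proof.
move=> eu uv; have qu0 : 0 < q u := lt_le_trans (expR_gt0 1) eu.
have qv0 : 0 < q v := lt_le_trans qu0 uv.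
have lu : 1 <= ln (q u) by rewrite -[leLHS](expRK 1) ler_ln ?posrE ?expR_gt0.
have luv : ln (q u) <= ln (q v) by rewrite ler_ln ?posrE.
have llu : 0 <= ln (ln (q u)) by exact: ln_ge0.
have lu0 : 0 < ln (q u) by exact: lt_le_trans ltr01 lu.
rewrite /Sigma; apply: ler_wsqrtr; apply: ler_pM.
- by rewrite mulr_ge0// ltW.
- exact: llu.
- by rewrite ler_pM2l.
- have lv0 := lt_le_trans lu0 luv.
  by rewrite ler_ln ?posrE.
Qed.

Context {d : measure_display} {T : measurableType d}.
Context {P : probability T R} {F : R -> set (set T)} {B : R -> T -> R}.
Hypotheses (usual_F : usual_filtration P F) (brownian_B : brownian_motion P F B).
Context {M : R -> T -> R}.
Hypothesis csigma : {within `[0, +oo[, continuous sigma}.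
Hypothesis ito_M : is_ito_process P F B sigma M.

(** The factor 2 comes from treating M and - M separately. *)
Lemma ito_maximal (t lam : R) : 0 < t -> 0 < q t -> 0 <= lam ->
  exists E : set T, [/\ measurable E,
    (P E <= (2 * expR (- (lam ^+ 2 / (2 * q t))))%:E)%E &
    forall w, {within `[0, +oo[, continuous (M ^~ w)} ->
    forall s, 0 <= s <= t -> lam < `|M s w| -> E w].
Proof.
move=> t0 qt0 lam0; have [aM _ _] := ito_M.
(* The parameter th = lam / q t minimises the exponent - th lam + th^2 q t / 2. *)
have th0 : 0 <= lam / q t by rewrite divr_ge0// ltW.
have expE : expR (- (lam / q t * lam)) * expR ((lam / q t) ^+ 2 * q t / 2) =
    expR (- (lam ^+ 2 / (2 * q t))).
  by rewrite -expRD; congr expR; field; rewrite gt_eqF.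
have [E1 [mE1 PE1] H1] := martingale_maximal_inequality (lam := lam) usual_F aM
  (ito_incr_integrable usual_F brownian_B csigma ito_M)
  (ito_martingale usual_F brownian_B csigma ito_M) th0
  (ito_mgf usual_F brownian_B csigma ito_M (lam / q t) (ltW t0)) t0.
pose N s w := - M s w.
have aN : adapted F N.
  move=> s s0; apply: (sub_measurable_comp (filtration_sigma usual_F s0)
    (g := fun y => - y)); last exact: aM.
  exact: oppr_measurable.
have iN s u : 0 <= s -> s <= u -> P.-integrable setT (EFin \o (N u \- N s)).
  move=> s0 su; have := ito_incr_integrable usual_F brownian_B csigma ito_M s0 su.
  move=> /integrableN; apply: eq_integrable => // w _ /=.
  by congr EFin; rewrite /N; ring.
have martN A s u : 0 <= s -> s <= u -> F s A ->
    (\int[P]_(w in A) (N u w - N s w)%:E = 0)%E.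
  move=> s0 su FA.
  have mA : measurable A by exact: (filtration_measurable usual_F s0).
  rewrite (eq_integral (fun w => (-1)%:E * (M u w - M s w)%:E)%E); last first.
    by move=> w _; rewrite -EFinM; congr EFin; rewrite /N; ring.
  rewrite integralZl//; last first.
    apply: (integrableS measurableT) => //.
    exact: (ito_incr_integrable usual_F brownian_B csigma ito_M).
  by rewrite (ito_martingale usual_F brownian_B csigma ito_M)// mule0.
have mgfN : (\int[P]_w (expR (lam / q t * N t w))%:E <=
    (expR ((lam / q t) ^+ 2 * q t / 2))%:E)%E.
  have := ito_mgf usual_F brownian_B csigma ito_M (- (lam / q t)) (ltW t0).
  rewrite sqrrN; apply: le_trans; rewrite le_eqVlt; apply/orP; left; apply/eqP.
  by apply: eq_integral => w _; rewrite /N mulNr mulrN.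
have [E2 [mE2 PE2] H2] := martingale_maximal_inequality (lam := lam) usual_F aN
  iN martN th0 mgfN t0.
exists (E1 `|` E2); split; first exact: measurableU.
- rewrite (le_trans (measureU2 _ mE1 mE2))// mulrDl mul1r EFinD -expE leeD//.
- move=> w cw s st; rewrite lter_normr => /orP[Ms|Ms].
    by left; exact: (H1 w cw s st).
  right; apply: (H2 w _ s st) => //.
  apply: (within_continuous_compR (h := fun z => - z) cw) => ? _.
  exact: oppr_continuous.
Qed.

Lemma quad_var_surj (y : R) : q t @[t --> +oo] --> +oo -> 0 <= y ->
  exists2 t, 0 <= t & q t = y.
Proof.
move=> /cvgryPge/(_ y) qy y0.
have [T0 [yT T00]] := filter_ex (filterI qy (nbhs_pinfty_ge (num_real 0))).
have cq := continuous_half_line_itv (quad_var_continuous csigma) (lexx 0).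
have [|c] := IVT (v := y) T00 (cq T0).
  rewrite quad_var0 min_l ?max_r ?y0//; exact: quad_var_ge0.
by rewrite in_itv/= => /andP[c0 _] qc; exists c.
Qed.

(** With threshold kappa S(t_n) and q(t_(n+1)) = kappa q(t_n), the exponent in [ito_maximal] is
    kappa log log q(t_n) = kappa log ((n+1) a). The probabilities are thus terms of a Riemann series
    of exponent kappa, up to the constant [c]. *)
Lemma ito_lil (kappa : R) : q t @[t --> +oo] --> +oo -> 1 < kappa ->
  {ae P, forall w, \forall t \near +oo, `|M t w| <= kappa * S t}.
Proof.
move=> qy k1; have [_ cM _] := ito_M; have k0 : 0 < kappa := lt_trans ltr01 k1.
pose a := ln kappa; have a0 : 0 < a by exact: ln_gt0.
have kE n : kappa ^+ n = expR (n%:R * a) by rewrite expRM_natl lnK.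
have /choice[tn tnP] n : exists t, 0 <= t /\ q t = kappa ^+ n.+1.
  have [|t t0 qt] := quad_var_surj qy (y := kappa ^+ n.+1).
    by rewrite exprn_ge0// ltW.
  by exists t.
have tn0 n : 0 <= tn n by case: (tnP n).
have qtn n : q (tn n) = kappa ^+ n.+1 by case: (tnP n).
have tn_gt0 n : 0 < tn n.
  rewrite lt_neqAle tn0 andbT; apply: contraTneq (exprn_gt0 n.+1 k0) => tnE.
  by rewrite -qtn -tnE quad_var0 ltxx.
(* From n0 on, q (tn n) = exp ((n + 1) a) exceeds e, so that the iterated logarithm is positive;
   earlier events are taken empty. *)
pose n0 := Num.truncn a^-1.
have n0P n : (n0 <= n)%N -> 1 < n.+1%:R * a.
  move=> n0n; rewrite -ltr_pdivrMr// div1r.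
  have : 0 <= a^-1 by rewrite invr_ge0 ltW.
  by move=> /truncn_itv/andP[_ /lt_le_trans]; apply; rewrite ler_nat ltnS.
pose c := 2 * expR (- (kappa * ln a)).
pose u n := expR (- (kappa * ln (n.+1%:R : R))).
have /choice[E EP] n : exists E : set T, [/\ measurable E, (P E <= (c * u n)%:E)%E &
    (n0 <= n)%N -> forall w, {within `[0, +oo[, continuous (M ^~ w)} ->
    forall s, 0 <= s <= tn n.+1 -> kappa * S (tn n) < `|M s w| -> E w].
  have [n0n|] := leqP n0 n; last first.
    move=> _; exists set0; split => //; rewrite measure0 lee_fin.
    by rewrite !mulr_ge0 ?expR_ge0.
  have qt1 : 0 < q (tn n.+1) by rewrite qtn exprn_gt0.
  have lam0 : 0 <= kappa * S (tn n) by rewrite mulr_ge0 ?sqrtr_ge0// ltW.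
  have [E' [mE PE HE]] := ito_maximal (tn_gt0 n.+1) qt1 lam0.
  exists E'; split => //; rewrite (le_trans PE)// lee_fin le_eqVlt.
  apply/orP; left; apply/eqP; rewrite /c /u -mulrA -expRD; congr (_ * expR _).
  have na : 0 < n.+1%:R * a by exact: lt_trans (n0P n n0n).
  have lnq : ln (q (tn n)) = n.+1%:R * a by rewrite qtn kE expRK.
  have S2 : S (tn n) ^+ 2 = 2 * q (tn n) * ln (n.+1%:R * a).
    rewrite /Sigma lnq sqr_sqrtr// mulr_ge0//.
      by rewrite mulr_ge0// quad_var_ge0.
    by rewrite ln_ge0// ltW// n0P.
  rewrite exprMn S2 !qtn lnM ?posrE ?ltr0n// [kappa ^+ n.+2]exprS.
  have kn0 : kappa ^+ n.+1 != 0 by rewrite gt_eqF// exprn_gt0.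
  by field; rewrite kn0 gt_eqF.
have mE n : measurable (E n) by case: (EP n).
have sumE : (\sum_(n <oo) P (E n) < +oo)%E.
  apply: (@le_lt_trans _ _ (c * (1 + (kappa - 1)^-1))%:E); last exact: ltry.
  apply: lime_le; first by apply: is_cvg_nneseries => n _ _; exact: measure_ge0.
  apply: nearW => n; apply: (@le_trans _ _ (\sum_(0 <= i < n) (c * u i)%:E)%E).
    by apply: lee_sum => i _; case: (EP i).
  rewrite sumEFin lee_fin -mulr_sumr ler_wpM2l//.
    by rewrite mulr_ge0// expR_ge0.
  exact: riemann_partial_sum.
have null : P (lim_sup_set E) = 0%E by exact: lim_sup_set_cvg0.
have ae_lim : {ae P, forall w, ~ lim_sup_set E w}.
  exists (lim_sup_set E); split => //.
    by apply: bigcap_measurable => // k _; exact: bigcup_measurable.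
  by move=> w /contrapT.
apply: filterS2 cM ae_lim => w cw nE.
have [n1 n1P] : exists n1, forall n, (n1 <= n)%N -> ~ E n w.
  apply: contrapT => nn; apply: nE => k _; apply: contrapT => nk; apply: nn.
  by exists k => n kn En; apply: nk; exists n.
pose n2 := maxn n0 n1.
have /cvgryPge/(_ (kappa ^+ n2.+1)) qn := qy.
near=> t.
have t0 : 0 <= t by near: t; exact: nbhs_pinfty_ge.
have qt : kappa ^+ n2.+1 <= q t by near: t; exact: qn.
have qt0 : 0 < q t by rewrite (lt_le_trans _ qt)// exprn_gt0.
have lnqt : n2.+1%:R * a <= ln (q t).
  by rewrite -[leLHS]expRK -kE ler_ln ?posrE// exprn_gt0.
(* This locates q t between kappa^k and kappa^(k+1), that is between q (tn n) and q (tn n.+1) for k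
   = n + 1. As q may be constant on intervals, the order of the times is then recovered from its
   monotonicity. *)
pose k := Num.truncn (ln (q t) / a).
have /andP[k_1 k_2] : k%:R <= ln (q t) / a < k.+1%:R.
  by apply: truncn_itv; rewrite divr_ge0 ?(ltW a0)// (le_trans _ lnqt)// mulr_ge0// ltW.
have n2k : (n2 < k)%N.
  by rewrite -ltnS -(ltr_nat R) (le_lt_trans _ k_2)// ler_pdivlMr.
have [n kn] : exists n, k = n.+1 by exists k.-1; rewrite prednK// (leq_ltn_trans _ n2k).
have n2n : (n2 <= n)%N by rewrite -ltnS -kn.
have qn1 : q (tn n) <= q t.
  by rewrite qtn -kn kE -[leRHS]lnK ?posrE// ler_expR -ler_pdivlMr.
have qn2 : q t < q (tn n.+1).
  by rewrite qtn -kn kE -[ltLHS]lnK ?posrE// ltr_expR -ltr_pdivrMr.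
have tt : t <= tn n.+1.
  rewrite leNgt; apply/negP => /ltW tnt.
  by move: qn2; rewrite ltNge quad_var_nd.
have n0n : (n0 <= n)%N by rewrite (leq_trans _ n2n)// leq_maxl.
have n1n : (n1 <= n)%N by rewrite (leq_trans _ n2n)// leq_maxr.
have [_ _ /(_ n0n w cw t)] := EP n; rewrite t0 tt => /(_ isT) HE.
have MS : `|M t w| <= kappa * S (tn n).
  by rewrite leNgt; apply/negP => /HE; exact: n1P.
apply: (le_trans MS); apply: ler_wpM2l; first exact: ltW.
apply: Sigma_le; last exact: qn1.
by rewrite qtn kE ler_expR ltW// n0P.
Unshelve. all: end_near. Qed.

End lil.

(** * The contraction argument *)

Section contraction.
Context {R : realType} {a S : R -> R} {T0 th kappa : R}.
Hypotheses (th0 : 0 <= th) (kappa1 : 1 <= kappa).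
Hypothesis S_gt0 : forall t, T0 <= t -> 0 < S t.
Hypothesis S_nd : forall s t, T0 <= s -> s <= t -> S s <= S t.
Hypothesis S_pinfty : S t @[t --> +oo] --> +oo.
Hypothesis continuous_aS : {within `[T0, +oo[, continuous (fun t => a t / S t)}.
Hypothesis feedback : forall T, T0 <= T -> exists2 C, 0 <= C &
  forall t lam, T <= t -> 1 <= lam -> (forall s, T <= s <= t -> a s <= lam * S s) ->
    a t <= C + (th * lam + kappa) * S t.

(** Let u maximise a / S on [T0, t], with value g > 1. Feedback at u with lam = g gives (1 - th) g
    <= C / S u + kappa, and S u >= S T0 makes the bound independent of t. *)
Lemma feedback_bounded : th < 1 ->
  exists2 lam, 1 <= lam & forall t, T0 <= t -> a t <= lam * S t.
Proof.
move=> th1; have [C C0 HC] := feedback (lexx T0).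
have th1' : 0 < 1 - th by rewrite subr_gt0.
pose lam := Num.max 1 ((C / S T0 + kappa) / (1 - th)).
exists lam; first by rewrite le_max lexx.
move=> t Tt.
have cS : {within `[T0, t], continuous (fun t => a t / S t)}.
  by apply: (continuous_subspaceW _ continuous_aS); apply: subset_itvl; rewrite bnd_simp.
have [u uTt umax] := EVT_max Tt cS.
have /andP[Tu ut] : T0 <= u <= t by move: uTt; rewrite in_itv.
have as_le s : T0 <= s <= u -> a s <= a u / S u * S s.
  move=> /andP[Ts su]; rewrite -ler_pdivrMr ?S_gt0//; apply: umax.
  by rewrite in_itv/= Ts (le_trans su).
have at_le : a t <= a u / S u * S t.
  by rewrite -ler_pdivrMr ?S_gt0//; apply: umax; rewrite in_itv/= Tt lexx.
rewrite (le_trans at_le)// ler_pM2r ?S_gt0// /lam le_max.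
have [//|u1] := leP (a u / S u) 1; rewrite /=.
have := HC u _ Tu (ltW u1) as_le.
have Su := S_gt0 Tu; set g := a u / S u.
have -> : a u = g * S u by rewrite /g divfK ?gt_eqF.
move=> h; rewrite ler_pdivlMr//.
have CS : C <= C / S T0 * S u.
  by rewrite mulrAC ler_pdivlMr ?S_gt0// ler_wpM2l// S_nd.
rewrite -(ler_pM2r Su); move: h CS; set r := C / S T0; nra.
Qed.

(** Since S diverges, C is eventually below e S, so feedback improves a bound lam to th lam + kappa
    + e. The excess over the fixed point [fp] of this map shrinks by the factor th at each round,
    starting from at most [D]. *)
Lemma volterra_contraction (c : R) : 0 < c -> kappa + c * th < c ->
  \forall t \near +oo, a t <= c * S t.
Proof.
move=> c0 kc.
have th1 : th < 1.
  rewrite ltNge; apply/negP => th1; have : c <= c * th by rewrite ler_peMr// ltW.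
  move=> cth; move: kc; rewrite ltNge (le_trans cth)// lerDr.
  exact: le_trans ler01 kappa1.
have th1' : 0 < 1 - th by rewrite subr_gt0.
(* Half of the available slack, which still leaves the perturbed fixed point below c. *)
pose e := (c * (1 - th) - kappa) / 2.
have e0 : 0 < e by rewrite divr_gt0//; lra.
pose fp := (kappa + e) / (1 - th).
have fpE : fp * (1 - th) = kappa + e by rewrite divfK// gt_eqF.
have fpc : fp < c by rewrite ltr_pdivrMr// /e; lra.
have fp1 : 1 <= fp.
  by rewrite ler_pdivlMr//; have := kappa1; have := th0; lra.
have [Lam Lam1 LamP] := feedback_bounded th1.
pose D := Num.max 0 (Lam - fp).
have D0 : 0 <= D by rewrite le_max lexx.
have LamD : Lam <= fp + D by rewrite -lerBlDl le_max lexx orbT.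
have iter n : \forall t \near +oo, a t <= (fp + th ^+ n * D) * S t.
  elim: n => [|n [T [_ IH]]].
    near=> t; have Tt : T0 <= t by near: t; apply: nbhs_pinfty_ge; exact: num_real.
    rewrite expr0 mul1r; apply: (le_trans (LamP t Tt)).
    by apply: ler_wpM2r => //; apply/ltW/S_gt0.
  (* The induction hypothesis holds only strictly after T, hence T + 1. *)
  pose T1 := Num.max T0 (T + 1).
  have T01 : T0 <= T1 by rewrite le_max lexx.
  have [C C0 HC] := feedback T01.
  have lam1 : 1 <= fp + th ^+ n * D.
    by rewrite (le_trans fp1)// lerDl mulr_ge0// exprn_ge0.
  have /cvgryPge/(_ (C / e)) SC := S_pinfty.
  near=> t.
  have T1t : T1 <= t by near: t; apply: nbhs_pinfty_ge; exact: num_real.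
  have CS : C <= e * S t.
    by rewrite mulrC -ler_pdivrMr//; near: t; exact: SC.
  have := HC t _ T1t lam1 => /(_ _)/le_trans; apply.
    move=> s /andP[T1s _]; apply: IH; rewrite (lt_le_trans _ T1s)//.
    by rewrite lt_max ltrDl ltr01 orbT.
  rewrite (le_trans (lerD CS (lexx _)))// -mulrDl ler_pM2r; last first.
    by rewrite S_gt0// (le_trans T01).
  rewrite exprS mulrDr [leRHS]addrC -mulrA; move: fpE; lra.
have [n nD] : exists n, th ^+ n * D <= c - fp.
  have cvg0 : (th ^+ n * D) @[n --> \oo] --> (0 : R).
    rewrite -(mul0r D); apply: cvgM; last exact: cvg_cst.
    by apply: cvg_expr; rewrite ger0_norm.
  have /cvgrPdist_le/(_ (c - fp)) := cvg0.
  rewrite subr_gt0 => /(_ fpc)[n _ /(_ n (leqnn n))/=].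
  rewrite sub0r normrN => h; exists n; exact: le_trans (ler_norm _) h.
have := iter n; apply: filterS2 (nbhs_pinfty_ge (num_real T0)) => t Tt /le_trans; apply.
by rewrite ler_pM2r ?S_gt0//; lra.
Unshelve. all: end_near. Qed.

End contraction.

(** * Concavity of phi *)

Section phi.
Context {R : realType} {phi dphi : R -> R}.
Hypothesis phi_gt0 : forall x : R, 0 <= x -> 0 < phi x.
Hypothesis phi_C1 : C1_with_derivative phi dphi.
Hypothesis dphi_gt0 : forall x : R, 0 <= x -> 0 < dphi x.
Hypothesis dphi_nonincreasing : forall x y : R, 0 <= x -> x <= y -> dphi y <= dphi x.

Lemma phi_continuous : {within `[0, +oo[, continuous phi}.
Proof.
apply/within_continuous_epsdelta => x /=; rewrite in_itv/= andbT => x0 e e0.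
have /(_ x x0)/cvgrPdist_lt/(_ 1 ltr01) := phi_C1.1.
rewrite near_withinE => /nbhs_ballP[r /= r0 H].
pose K := `|dphi x| + 1; have K0 : 0 < K by rewrite ltr_wpDl.
exists (Num.min r (e / K)); first by rewrite lt_min r0 divr_gt0.
move=> y /=; rewrite in_itv/= andbT => y0; rewrite lt_min => /andP[xyr xye].
have [->|yx] := eqVneq x y; first by rewrite subrr normr0.
have yx' : y - x != 0 by rewrite subr_eq0 eq_sym.
have := H y xyr; rewrite eq_sym => /(_ yx) /(_ _)/=.
rewrite in_itv/= y0 => /(_ isT) Hy.
have qK : `|(phi y - phi x) / (y - x)| < K.
  rewrite -[X in `|X|](subrK (dphi x)) (le_lt_trans (ler_normD _ _))// addrC.
  by rewrite ltrD2l distrC.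
have -> : phi x - phi y = - ((phi y - phi x) / (y - x) * (y - x)).
  by rewrite divfK// opprB.
rewrite normrN normrM -[ltRHS](divfK (lt0r_neq0 K0)) mulrC.
by apply: ltr_pM => //; rewrite distrC.
Qed.

(** At an interior point the restriction to the half-line is void for small increments, so the
    relative derivative is an ordinary one. *)
Lemma is_derive_phi (x : R) : 0 < x -> is_derive x 1 phi (dphi x).
Proof.
move=> x0.
have cvgd : h^-1 *: ((phi \o shift x) (h *: (1 : R)) - phi x) @[h --> 0^'] --> dphi x.
  apply/cvgrPdist_lt => e e0.
  have /(_ x (ltW x0))/cvgrPdist_lt/(_ e e0) := phi_C1.1.
  rewrite near_withinE => /nbhs_ballP[r /= r0 H].
  (* The bound |h| < x keeps h + x in the half-line. *)
  apply/nbhs_ballP; exists (Num.min r x); first by rewrite /= lt_min r0 x0.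
  move=> h; rewrite /ball/= sub0r normrN lt_min => /andP[hr hx] h0.
  have yx : h + x != x by rewrite -subr_eq0 addrK.
  have := H (h + x); rewrite /ball/= opprD addrCA subrr addr0 normrN.
  move=> /(_ hr yx); rewrite in_itv/= andbT.
  have y0 : 0 <= h + x.
    by move: hx; rewrite ltr_norml => /andP[]; lra.
  move=> /(_ y0); rewrite addrK /= [h *: _]mulr1.
  by rewrite [_ *: _]mulrC.
apply: DeriveDef; first by apply/cvg_ex; eexists; exact: cvgd.
exact: cvg_lim cvgd.
Qed.

Lemma phi_MVT (x y : R) : 0 <= x -> x <= y ->
  exists2 c, x <= c <= y & phi y - phi x = dphi c * (y - x).
Proof.
move=> x0 xy.
have dE z : z \in `]x, y[ -> is_derive z 1 phi (dphi z).
  by rewrite in_itv/= => /andP[xz _]; apply: is_derive_phi; exact: le_lt_trans xz.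
have cxy := continuous_half_line_itv phi_continuous x0.
have [c] := MVT_segment xy dE (cxy y).
by rewrite in_itv/= => xcy E; exists c.
Qed.

Lemma phi_nd (x y : R) : 0 <= x -> x <= y -> phi x <= phi y.
Proof.
move=> x0 xy; have [c /andP[xc _] E] := phi_MVT x0 xy.
by rewrite -subr_ge0 E mulr_ge0 ?subr_ge0// ltW// dphi_gt0// (le_trans x0).
Qed.

(** Past y the slope is at most dphi y, and up to y it is at least dphi y, so dphi y times y is at
    most phi y - phi 0 < phi y. *)
Lemma phi_sublinear (c y : R) : 1 <= c -> 0 <= y -> phi (c * y) <= c * phi y.
Proof.
move=> c1 y0.
have ycy : y <= c * y by rewrite ler_peMl.
have [u /andP[u0 uy] Eu] := phi_MVT (lexx 0) y0.
have [v /andP[yv _] Ev] := phi_MVT y0 ycy.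
have d1 := dphi_nonincreasing u0 uy.
have d2 := dphi_nonincreasing y0 yv.
have p0 := phi_gt0 (lexx 0).
have h1 : dphi y * y <= phi y - phi 0 by rewrite Eu subr0 ler_wpM2r.
have h2 : phi (c * y) - phi y <= dphi y * (c * y - y).
  by rewrite Ev ler_wpM2r// subr_ge0.
have h3 : (c - 1) * (dphi y * y) <= (c - 1) * phi y.
  by rewrite ler_wpM2l ?subr_ge0//; lra.
lra.
Qed.

End phi.

(** * Kernel and normalising function *)

Section lipschitz.
Context {R : realType} {f : R -> R}.

Lemma locally_lipschitz_continuous :
  [locally [lipschitz f x | x in [set: R]]] -> continuous f.
Proof.
move=> fl x; have xx : ([set: R] `*` [set: R]) (x, x) by [].
have := fl _ xx; rewrite /lipschitz_on => flx.
have [M [HM M0]] := filter_ex (filterI flx (nbhs_pinfty_gt (num_real 0))).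
have /nbhs_ballP[r /= r0 H] := HM.
apply/cvgrPdist_lt => e e0; apply/nbhs_ballP.
exists (Num.min r (e / M)); first by rewrite /= lt_min r0 divr_gt0.
move=> y; rewrite /ball/= lt_min => /andP[xyr xye].
have := H (x, y) (conj (ballxx _ r0) xyr) (conj I I).
move=> /= /le_lt_trans; apply.
by rewrite mulrC -ltr_pdivlMr.
Qed.

End lipschitz.

Section kernel.
Context {R : realType} {mu : {measure set (measurableTypeR R) -> \bar R}}.
Hypothesis mu_lty : (mu `[0%R, +oo[%classic < +oo)%E.
Local Notation k := (kernel_of mu).

Lemma measure_half_line_fin (A : set (measurableTypeR R)) :
  measurable A -> A `<=` `[0, +oo[ -> mu A \is a fin_num.
Proof.
move=> mA A0; rewrite ge0_fin_numE// (le_lt_trans _ mu_lty)//.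
by rewrite le_measure// inE//; exact: measurable_itv.
Qed.

Lemma kernel_nd : {homo k : s t / s <= t}.
Proof.
move=> s t st; rewrite /kernel_of fine_le//.
- by apply: measure_half_line_fin => //; apply: subset_itvl; rewrite bnd_simp.
- by apply: measure_half_line_fin => //; apply: subset_itvl; rewrite bnd_simp.
- rewrite le_measure// ?inE//.
  by apply: subset_itvl; rewrite bnd_simp.
Qed.

Lemma kernel_ge0 t : 0 <= k t.
Proof. by rewrite fine_ge0. Qed.

Lemma kernel_le_mass t : k t <= total_mass mu.
Proof.
rewrite /kernel_of fine_le//.
- by apply: measure_half_line_fin => //; apply: subset_itvl; rewrite bnd_simp.
- by apply: measure_half_line_fin => //; exact: measurable_itv.
- rewrite le_measure// ?inE//.
  by apply: subset_itvl; rewrite bnd_simp.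
Qed.

(** Bounding the kernel by the total mass removes the memory: what remains is a plain integral of
    |g|, which can be split at any time. *)
Lemma convolution_bound (g : R -> R) (t : R) : {within `[0, t], continuous g} ->
  `|\int[lebesgue_measure]_(s in `[0, t]) (k (t - s) * g s)| <=
  total_mass mu * \int[lebesgue_measure]_(s in `[0, t]) `|g s|.
Proof.
move=> cg; have ig := continuous_itv_integrable cg.
have ing : lebesgue_measure.-integrable `[0, t] (fun s => `|g s|%:E).
  exact: integrable_norm.
have inkg : lebesgue_measure.-integrable `[0, t] (fun s => (total_mass mu * `|g s|)%:E).
  have -> : (fun s => (total_mass mu * `|g s|)%:E) =
      (fun s => (total_mass mu)%:E * `|g s|%:E)%E by apply/funext.
  exact: integrableZl.
have mk : measurable_fun (`[0, t] : set R) (fun s => k (t - s)).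
  apply: nonincreasing_measurable => // u v uv.
  by apply: kernel_nd; rewrite lerD2l lerN2.
have kg s : `|k (t - s) * g s| <= total_mass mu * `|g s|.
  by rewrite normrM (ger0_norm (kernel_ge0 _)) ler_wpM2r// kernel_le_mass.
have mg : measurable_fun (`[0, t] : set R) g.
  by apply/measurable_EFinP; exact: measurable_int ig.
have ikg : lebesgue_measure.-integrable `[0, t] (fun s => (k (t - s) * g s)%:E).
  apply: le_integrable inkg => //.
    by apply/measurable_EFinP; exact: measurable_funM.
  by move=> s _; rewrite lee_fin (le_trans (kg s))// ler_norm.
rewrite (le_trans (le_normr_Rintegral _ _))// -RintegralZl//.
by apply: le_Rintegral => //; exact: integrable_norm.
Qed.

End kernel.

Section itv_integral.
Context {R : realType}.

Lemma Rintegral_itv_diff (g : R -> R) (a u v : R) :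
  {within `[a, v], continuous g} -> a <= u -> u <= v ->
  \int[lebesgue_measure]_(s in `[u, v]) g s =
  \int[lebesgue_measure]_(s in `[a, v]) g s -
  \int[lebesgue_measure]_(s in `[a, u]) g s.
Proof.
move=> cg au uv; have ig := continuous_itv_integrable cg.
rewrite Rintegral_itvB ?bnd_simp// -Rintegral_itv_obnd_cbnd//.
apply: (integrableS _ _ _ ig) => //.
by apply: subset_itvr; rewrite bnd_simp.
Qed.

End itv_integral.

Section Sigma.
Context {R : realType} {sigma : R -> R}.
Hypothesis csigma : {within `[0, +oo[, continuous sigma}.
Hypothesis q_pinfty : quad_var sigma t @[t --> +oo] --> +oo.
Context {t0 : R}.
Hypotheses (t0_ge0 : 0 <= t0) (quad_var_t0 : expR 1 < quad_var sigma t0).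
Local Notation q := (quad_var sigma).
Local Notation S := (Sigma sigma).

Lemma quad_var_gte (t : R) : t0 <= t -> expR 1 < q t.
Proof. by move=> t0t; rewrite (lt_le_trans quad_var_t0)// quad_var_nd. Qed.

Lemma lnln_gt0 (y : R) : expR 1 < y -> 0 < ln (ln y).
Proof.
move=> ey; apply: ln_gt0; rewrite -[ltLHS](expRK 1) ltr_ln ?posrE ?expR_gt0//.
exact: lt_trans (expR_gt0 1) ey.
Qed.

Lemma Sigma_gt0 (t : R) : t0 <= t -> 0 < S t.
Proof.
move=> t0t; have eq := quad_var_gte t0t.
rewrite /Sigma sqrtr_gt0 mulr_gt0//; last exact: lnln_gt0.
by rewrite mulr_gt0// (lt_trans (expR_gt0 1)).
Qed.

Lemma Sigma_nd (s t : R) : t0 <= s -> s <= t -> S s <= S t.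
Proof.
move=> t0s st; apply: Sigma_le; first exact/ltW/quad_var_gte.
by apply: quad_var_nd => //; exact: le_trans t0s.
Qed.

Lemma Sigma_continuous : {within `[t0, +oo[, continuous S}.
Proof.
have cq : {within `[t0, +oo[, continuous q}.
  apply: (continuous_subspaceW _ (quad_var_continuous csigma)).
  by apply: subset_itvr; rewrite bnd_simp.
apply: (within_continuous_compR (h := fun y => Num.sqrt (2 * y * ln (ln y))) cq).
move=> t /=; rewrite in_itv/= andbT => /quad_var_gte eq.
have q0 : 0 < q t by exact: lt_trans (expR_gt0 1) eq.
have lq : 0 < ln (q t).
  by rewrite ln_gt0// (lt_trans _ eq)// expR_gt1.
apply: (@continuous_comp _ _ _ (fun y : R => 2 * y * ln (ln y)) Num.sqrt);
  last exact: sqrt_continuous.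
apply: cvgM.
  by apply: cvgM; [exact: cvg_cst|exact: cvg_id].
by apply: (@continuous_comp _ _ _ (@ln R) (@ln R)); exact: continuous_ln.
Qed.

Lemma Sigma_pinfty : S t @[t --> +oo] --> +oo.
Proof.
apply/cvgryPge => A.
(* Beyond exp (exp 1) the iterated logarithm is at least 1, so the square of Sigma dominates q,
   hence A^2. *)
have /cvgryPge/(_ (Num.max (A ^+ 2) (expR (expR 1)))) := q_pinfty.
apply: filterS => t; rewrite ge_max => /andP[Aq eq].
have q0 : 0 < q t := lt_le_trans (expR_gt0 _) eq.
have llq : 1 <= ln (ln (q t)).
  have h1 : expR 1 <= ln (q t) by rewrite -[leLHS]expRK ler_ln ?posrE ?expR_gt0.
  rewrite -[leLHS](expRK 1) ler_ln ?posrE ?expR_gt0//.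
  exact: lt_le_trans (expR_gt0 1) h1.
apply: (le_trans (ler_norm A)); rewrite -sqrtr_sqr /Sigma; apply: ler_wsqrtr.
apply: (le_trans Aq).
have : q t * 1 <= q t * ln (ln (q t)) by apply: ler_wpM2l => //; exact: ltW.
move: (ln (ln (q t))) llq => l llq; move: (q t) q0 => y y0; nra.
Qed.

End Sigma.

(** * Pathwise bound *)

Section path.
Context {R : realType} {mu : {measure set (measurableTypeR R) -> \bar R}}.
Context {sigma f phi dphi : R -> R} {t0 L : R}.
Hypotheses (mu_gt0 : (0 < mu `[0%R, +oo[%classic)%E)
  (mu_lty : (mu `[0%R, +oo[%classic < +oo)%E).
Hypothesis csigma : {within `[0, +oo[, continuous sigma}.
Hypothesis q_pinfty : quad_var sigma t @[t --> +oo] --> +oo.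
Hypothesis f_lipschitz : [locally [lipschitz f x | x in [set: R]]].
Hypothesis phi_gt0 : forall x : R, 0 <= x -> 0 < phi x.
Hypothesis phi_C1 : C1_with_derivative phi dphi.
Hypothesis dphi_gt0 : forall x : R, 0 <= x -> 0 < dphi x.
Hypothesis phi_pinfty : phi x @[x --> +oo] --> +oo.
Hypothesis dphi_nonincreasing : forall x y : R, 0 <= x -> x <= y -> dphi y <= dphi x.
Hypothesis f_phi : f x / phi x @[x --> +oo] --> (1 : R).
Hypothesis abs_f_phi : `|f x| / phi `|x| @[x --> abs_pinfty_nbhs] --> (1 : R).
Hypotheses (t0_ge0 : 0 <= t0) (quad_var_t0 : expR 1 < quad_var sigma t0).
Hypothesis L_limit : Sigma_ratio mu f sigma t0 t @[t --> +oo] --> L.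
Hypothesis L_gt1 : 1 < L.
Local Notation leb := (@lebesgue_measure R).
Local Notation S := (Sigma sigma).
Local Notation m := (total_mass mu).

Let cf : continuous f. Proof. exact: locally_lipschitz_continuous. Qed.

Lemma total_mass_gt0 : 0 < m.
Proof. by rewrite fine_gt0// mu_gt0. Qed.

(** For large |z|, |f z| <= kappa phi |z| <= kappa phi (lam y) <= kappa lam phi y. For the remaining
    z, f is bounded, and phi y exceeds that bound once y is large. It matters that Y does not depend
    on lam, which changes along the iteration. *)
Lemma f_phi_bound (kappa : R) : 1 < kappa ->
  exists Y, forall y lam z, Y <= y -> 0 <= y -> 1 <= lam -> `|z| <= lam * y ->
    `|f z| <= kappa * lam * phi y.
Proof.
move=> k1; have k0 : 0 < kappa by exact: lt_trans k1.
have [M HM] : exists M, forall x, M < `|x| -> `|f x| / phi `|x| < kappa.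
  have nk : nbhs (1 : R) [set r | r < kappa] by exact: lt_nbhsl.
  by have [M HM] := abs_f_phi nk; exists M.
pose M1 := Num.max M 0.
have M10 : 0 <= M1 by rewrite le_max lexx orbT.
have cfM : {within `[- M1, M1], continuous (fun x => `|f x|)}.
  apply: continuous_subspaceT => x.
  by apply: (@continuous_comp _ _ _ f Num.norm); [exact: cf|exact: norm_continuous].
have NM : - M1 <= M1 by rewrite ge0_cp.
have [u _ umax] := EVT_max NM cfM.
have /cvgryPge/(_ `|f u|) [Y [_ HY]] := phi_pinfty.
exists (Y + 1) => y lam z Yy y0 lam1 zy.
have phiy : 0 < phi y by exact: phi_gt0.
have lam0 : 0 < lam by exact: lt_le_trans lam1.
have [zM|Mz] := leP `|z| M1.
  apply: (@le_trans _ _ (phi y)).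
    apply: (@le_trans _ _ `|f u|).
      by apply: umax; rewrite in_itv/= -ler_norml.
    by apply: HY; rewrite (lt_le_trans _ Yy)// ltrDl.
  rewrite ler_peMl ?(ltW phiy)//.
  by rewrite (le_trans lam1)// ler_peMl ?ltW.
have := HM z; rewrite (le_lt_trans _ Mz) ?le_max ?lexx// => /(_ isT).
rewrite ltr_pdivrMr ?phi_gt0// => /ltW/le_trans; apply.
rewrite -mulrA ler_pM2l//; apply: (@le_trans _ _ (phi (lam * y))).
  exact: (phi_nd phi_C1 dphi_gt0).
exact: (phi_sublinear phi_gt0 phi_C1 dphi_nonincreasing).
Qed.

Lemma continuous_comp_Sigma (g : R -> R) (a b : R) : continuous g -> t0 <= a ->
  {within `[a, b], continuous (fun s => g (S s))}.
Proof.
move=> cg t0a.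
have cS : {within `[a, b], continuous S}.
  apply: (continuous_subspaceW _ (Sigma_continuous csigma t0_ge0 quad_var_t0)).
  by apply: subset_itv; rewrite bnd_simp.
apply: (within_continuous_compR (h := g) cS) => x _; exact: cg.
Qed.

Lemma continuous_phi_Sigma (a b : R) : t0 <= a ->
  {within `[a, b], continuous (fun s => phi (S s))}.
Proof.
move=> t0a.
have cS : {within `[a, b], continuous S}.
  apply: (continuous_subspaceW _ (Sigma_continuous csigma t0_ge0 quad_var_t0)).
  by apply: subset_itv; rewrite bnd_simp.
apply: (within_continuous_compR (h := phi) cS) => x.
rewrite /= in_itv/= => /andP[ax _]; apply: differentiable_continuous.
apply/derivable1_diffP.
have S0 : 0 < S x.
  by apply: (Sigma_gt0 csigma t0_ge0 quad_var_t0); exact: le_trans ax.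
by have [] := is_derive_phi phi_C1 S0.
Qed.

(** The limit L controls the integral of f(Sigma) from t0. Replacing f by phi costs a factor 1 +
    del, and changing the lower limit costs a constant, eventually below del S t. *)
Lemma phi_Sigma_integral_le (rho : R) : L^-1 < rho ->
  exists2 T, t0 <= T & forall T' t, T <= T' -> T' <= t ->
    m * \int[leb]_(s in `[T', t]) phi (S s) <= rho * S t.
Proof.
move=> Lrho; have L0 : 0 < L by exact: lt_trans L_gt1.
have m0 := total_mass_gt0.
have iL0 : 0 < L^-1 by rewrite invr_gt0.
pose a := (rho + L^-1) / 2.
have aL : L^-1 < a by rewrite /a; lra.
have arho : a < rho by rewrite /a; lra.
have a0 : 0 < a by exact: lt_trans aL.
(* As del <= 1, (1 + del)(a + del) <= a + del (2 + a), and the second term of the minimum brings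
   this below rho. *)
pose del := Num.min 1 ((rho - a) / (2 + a)).
have del0 : 0 < del by rewrite lt_min ltr01 divr_gt0 ?subr_gt0// addr_gt0.
have del1 : del <= 1 by rewrite ge_min lexx.
have delE : del * (2 + a) <= rho - a.
  by rewrite -ler_pdivlMr ?addr_gt0// ge_min lexx orbT.
have drho : (1 + del) * (a + del) <= rho by nra.
have S_pinfty := Sigma_pinfty q_pinfty.
have [y0 [_ Hy0]] : \forall y \near +oo, phi y <= (1 + del) * f y.
  have ndel : nbhs (1 : R) [set r | (1 + del)^-1 < r].
    by apply: lt_nbhsr; rewrite invf_lt1 ?ltrDl// addr_gt0.
  have := f_phi ndel; apply: filterS2 (nbhs_pinfty_ge (num_real 0)) => y yge0 /= h.
  have py := phi_gt0 yge0; move: h.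
  rewrite ltr_pdivlMr// => /ltW h.
  by rewrite -ler_pdivrMl ?addr_gt0.
have /cvgryPge/(_ (y0 + 1))[T1 [_ HT1]] := S_pinfty.
pose T2 := Num.max t0 (T1 + 1).
have t0T2 : t0 <= T2 by rewrite le_max lexx.
have phif s : T2 <= s -> phi (S s) <= (1 + del) * f (S s).
  move=> Ts; apply: Hy0; have : y0 + 1 <= S s.
    by apply: HT1; rewrite (lt_le_trans _ Ts)// lt_max ltrDl ltr01 orbT.
  by apply: lt_le_trans; rewrite ltrDl.
have fS0 s : T2 <= s -> 0 <= f (S s).
  move=> Ts; have := phif s Ts.
  have /ltW ps : 0 < phi (S s).
    apply: phi_gt0; apply: ltW.
    by apply: (Sigma_gt0 csigma t0_ge0 quad_var_t0); exact: le_trans Ts.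
  by move=> /(le_trans ps); rewrite pmulr_rge0// addr_gt0.
pose A t := m * \int[leb]_(s in `[t0, t]) f (S s).
have AS : \forall t \near +oo, A t <= a * S t.
  have nL : nbhs L [set r | a^-1 < r].
    by apply: lt_nbhsr; rewrite invf_plt ?posrE.
  have := L_limit nL; apply: filterS2 (nbhs_pinfty_ge (num_real t0)) => t t0t /= h.
  have St : 0 < S t by exact: (Sigma_gt0 csigma t0_ge0 quad_var_t0).
  (* The ratio exceeds a^-1 > 0, which excludes A t <= 0; for A t = 0 the quotient would be 0 by
     convention. *)
  have At0 : 0 < A t.
    rewrite ltNge; apply/negP => At0.
    have : Sigma_ratio mu f sigma t0 t <= 0.
      by rewrite /Sigma_ratio mulr_ge0_le0 ?(ltW St)// invr_le0.
    by rewrite leNgt (lt_trans _ h)// invr_gt0.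
  move: h; rewrite /Sigma_ratio -/(A t) ltr_pdivlMr// -ltr_pdivlMl ?invr_gt0//.
  by rewrite invrK => /ltW.
have AT : \forall t \near +oo, `|A T2| <= del * S t.
  have /cvgryPge/(_ (`|A T2| / del)) := S_pinfty.
  by apply: filterS => t; rewrite ler_pdivrMr// mulrC.
have [T3 [_ HT3]] := filterI AS AT.
pose T := Num.max T2 (T3 + 1).
have T2T : T2 <= T by rewrite le_max lexx.
exists T; first exact: le_trans T2T.
move=> T' t TT' T't.
have T2T' : T2 <= T' by exact: le_trans TT'.
have T2t : T2 <= t by exact: le_trans T't.
have t0T' : t0 <= T' by exact: le_trans T2T'.
have t0t : t0 <= t by exact: le_trans T2t.
have St : 0 < S t by exact: (Sigma_gt0 csigma t0_ge0 quad_var_t0).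
have [At AT2] : A t <= a * S t /\ `|A T2| <= del * S t.
  apply: HT3; rewrite (lt_le_trans _ (le_trans TT' T't))// lt_max ltrDl ltr01.
  by rewrite orbT.
have cfS u v : t0 <= u -> {within `[u, v], continuous (fun s => f (S s))}.
  by move=> t0u; exact: continuous_comp_Sigma.
have ifS u v : t0 <= u -> leb.-integrable `[u, v] (fun s => (f (S s))%:E).
  by move=> t0u; apply: continuous_itv_integrable; exact: cfS.
have h1 : \int[leb]_(s in `[T', t]) phi (S s) <=
    (1 + del) * \int[leb]_(s in `[T', t]) f (S s).
  rewrite -RintegralZl//; last exact: ifS.
  apply: le_Rintegral => //.
  - by apply: continuous_itv_integrable; exact: continuous_phi_Sigma.
  - have -> : EFin \o (fun s => (1 + del) * f (S s)) =
        (fun s => (1 + del)%:E * (f (S s))%:E)%E by apply/funext.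
    by apply: integrableZl => //; exact: ifS.
  - by move=> s /=; rewrite in_itv/= => /andP[Ts _]; apply: phif; exact: le_trans Ts.
(* Past T2 the integrand is nonnegative, so T' may be lowered to T2; the correction A T2 is then the
   same for every T'. *)
have h2 : \int[leb]_(s in `[T', t]) f (S s) <=
    \int[leb]_(s in `[t0, t]) f (S s) - \int[leb]_(s in `[t0, T2]) f (S s).
  rewrite (Rintegral_itv_diff (cfS t0 t (lexx _)) t0T' T't) lerD2l lerN2.
  rewrite -subr_ge0 -(Rintegral_itv_diff (cfS t0 T' (lexx _)) t0T2 T2T').
  by apply: Rintegral_ge0 => s /=; rewrite in_itv/= => /andP[/fS0].
have h3 : m * \int[leb]_(s in `[T', t]) f (S s) <= A t - A T2.
  by rewrite /A -mulrBr ler_pM2l.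
have h4 : m * \int[leb]_(s in `[T', t]) f (S s) <= (a + del) * S t.
  rewrite (le_trans h3)// mulrDl lerD// (le_trans _ AT2)//.
  by rewrite -normrN ler_norm.
apply: (@le_trans _ _ ((1 + del) * ((a + del) * S t))).
  apply: (@le_trans _ _ (m * ((1 + del) * \int[leb]_(s in `[T', t]) f (S s)))).
    by rewrite ler_pM2l.
  by rewrite mulrCA ler_pM2l// addr_gt0.
by rewrite mulrA ler_pM2r.
Qed.

(** [volterra_contraction] is applied with th = kappa rho, which is close to 1 / L when kappa is
    close to 1 and rho to 1 / L. *)
Lemma path_bound (x M : R -> R) (x0 c : R) :
  {within `[0, +oo[, continuous x} ->
  (forall t, 0 <= t -> x t = x0 +
    \int[leb]_(s in `[0, t]) (kernel_of mu (t - s) * f (x s)) + M t) ->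
  (forall kappa, 1 < kappa -> \forall t \near +oo, `|M t| <= kappa * S t) ->
  L / (L - 1) < c ->
  \forall t \near +oo, `|x t| <= c * S t.
Proof.
move=> cx xE HM Lc; have L0 : 0 < L by exact: lt_trans L_gt1.
have L1 : 0 < L - 1 by rewrite subr_gt0.
have m0 := total_mass_gt0.
have iL0 : 0 < L^-1 by rewrite invr_gt0.
have iL1 : L^-1 < 1 by rewrite invf_lt1.
have c1 : 1 < c by rewrite (lt_trans _ Lc)// ltr_pdivlMr//; lra.
have c0 : 0 < c by exact: lt_trans c1.
(* The condition L / (L - 1) < c is equivalent to h > 0. *)
pose h := c - 1 - c / L.
have h0 : 0 < h.
  move: Lc; rewrite ltr_pdivrMr// => Lc.
  have : 0 < (c * (L - 1) - L) / L by rewrite divr_gt0// subr_gt0.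
  suff -> : (c * (L - 1) - L) / L = h by [].
  by rewrite /h; field; rewrite gt_eqF.
(* Since 1 / L < 1 and eta < 1, kappa + c kappa rho exceeds 1 + c / L by at most eta (1 + 3 c),
   which this choice makes smaller than h. *)
pose eta := h / (2 * (1 + 3 * c)).
have d0 : 0 < 2 * (1 + 3 * c) by lra.
have eta0 : 0 < eta by rewrite divr_gt0.
have hc : h < c.
  have : 0 < c / L by rewrite divr_gt0.
  by rewrite /h; lra.
have eta1 : eta < 1 by rewrite ltr_pdivrMr//; lra.
have etah : eta * (1 + 3 * c) < h.
  have : eta * (2 * (1 + 3 * c)) = h by rewrite divfK// gt_eqF.
  lra.
pose kappa := 1 + eta; pose rho := L^-1 + eta.
have k1 : 1 < kappa by rewrite ltrDl.
have k0 : 0 < kappa by exact: lt_trans k1.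
have Lrho : L^-1 < rho by rewrite ltrDl.
have rho0 : 0 < rho by exact: lt_trans Lrho.
have kc : kappa + c * (kappa * rho) < c.
  have e1 : eta * (c * L^-1) <= eta * c.
    by rewrite ler_pM2l// ler_piMr// ltW.
  have e2 : eta * (eta * c) <= eta * c by rewrite ler_piMl ?ltW// mulr_gt0.
  have -> : kappa + c * (kappa * rho) =
      1 + c / L + eta * c + eta + eta * (c * L^-1) + eta * (eta * c).
    by rewrite /kappa /rho; ring.
  rewrite /h in etah; lra.
have [Y HY] := f_phi_bound k1.
have [T1 t0T1 HT1] := phi_Sigma_integral_le Lrho.
have S_pinfty := Sigma_pinfty q_pinfty.
have /cvgryPge/(_ Y)[T2 [_ HT2]] := S_pinfty.
have [T3 [_ HT3]] := HM kappa k1.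
pose T0 := Num.max T1 (Num.max (T2 + 1) (T3 + 1)).
have T1T0 : T1 <= T0 by rewrite le_max lexx.
have T2T0 : T2 < T0 by rewrite !lt_max ltrDl ltr01 /= orbT.
have T3T0 : T3 < T0.
  have T3S : T3 < T3 + 1 by rewrite ltrDl.
  by rewrite !lt_max T3S !orbT.
have t0T0 : t0 <= T0 by exact: le_trans T1T0.
have T00 : 0 <= T0 by exact: le_trans t0T0.
have Spos t : T0 <= t -> 0 < S t.
  by move=> Tt; apply: (Sigma_gt0 csigma t0_ge0 quad_var_t0); exact: le_trans Tt.
have cfx : {within `[0, +oo[, continuous (fun s => `|f (x s)|)}.
  apply: (within_continuous_compR (h := fun y => `|f y|) cx) => y _.
  by apply: (@continuous_comp _ _ _ f Num.norm); [exact: cf|exact: norm_continuous].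
have cfx0 : {within `[0, +oo[, continuous (fun s => f (x s))}.
  by apply: (within_continuous_compR (h := f) cx) => y _; exact: cf.
have feedbackP T : T0 <= T -> exists2 C, 0 <= C & forall t lam,
    T <= t -> 1 <= lam -> (forall s, T <= s <= t -> `|x s| <= lam * S s) ->
    `|x t| <= C + (kappa * rho * lam + kappa) * S t.
  move=> T0T; have T_ge0 : 0 <= T by exact: le_trans T0T.
  (* C gathers the initial value and the memory of [0, T]; it depends neither on t nor on lam. *)
  exists (`|x0| + m * \int[leb]_(s in `[0, T]) `|f (x s)|).
    by rewrite addr_ge0// mulr_ge0 ?(ltW m0)// Rintegral_ge0.
  move=> t lam Tt lam1 Hx; have tge0 : 0 <= t by exact: le_trans Tt.
  have T0t : T0 <= t by exact: le_trans Tt.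
  have St := Spos t T0t.
  have lam0 : 0 < lam by exact: lt_le_trans lam1.
  have cft : {within `[0, t], continuous (fun s => `|f (x s)|)}.
    exact: continuous_half_line_itv cfx (lexx 0).
  have cfTt : {within `[T, t], continuous (fun s => `|f (x s)|)}.
    exact: continuous_half_line_itv cfx T_ge0.
  have split_int : \int[leb]_(s in `[0, t]) `|f (x s)| =
      \int[leb]_(s in `[0, T]) `|f (x s)| + \int[leb]_(s in `[T, t]) `|f (x s)|.
    by rewrite (Rintegral_itv_diff cft T_ge0 Tt) addrC subrK.
  have t0T : t0 <= T by exact: le_trans T0T.
  have iphi : leb.-integrable `[T, t] (fun s => (phi (S s))%:E).
    by apply: continuous_itv_integrable; exact: continuous_phi_Sigma.
  have intT : m * \int[leb]_(s in `[T, t]) `|f (x s)| <= kappa * rho * lam * S t.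
    apply: (@le_trans _ _ (m * (kappa * lam * \int[leb]_(s in `[T, t]) phi (S s)))).
      rewrite ler_pM2l// -RintegralZl//; apply: le_Rintegral => //.
      - exact: continuous_itv_integrable.
      - have -> : EFin \o (fun s => kappa * lam * phi (S s)) =
            (fun s => (kappa * lam)%:E * (phi (S s))%:E)%E by apply/funext.
        exact: integrableZl.
      - move=> s /=; rewrite in_itv/= => /andP[Ts st].
        have T0s : T0 <= s by exact: le_trans Ts.
        apply: HY.
        + by apply: HT2; exact: lt_le_trans T0s.
        + exact/ltW/Spos.
        + exact: lam1.
        + by apply: Hx; rewrite Ts.
    rewrite mulrCA (_ : kappa * rho * lam * S t = kappa * lam * (rho * S t)); last by ring.
    by rewrite ler_pM2l ?mulr_gt0//; apply: HT1 => //; exact: le_trans T0T.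
  have := convolution_bound mu_lty (continuous_half_line_itv cfx0 (lexx 0) (b := t)).
  rewrite split_int mulrDr => conv.
  have Mt : `|M t| <= kappa * S t by apply: HT3; exact: lt_le_trans T0t.
  rewrite xE// (le_trans (ler_normD _ _))// (le_trans (lerD (ler_normD _ _) Mt))//.
  move: conv intT; set I0 := \int[leb]_(s in `[0, t]) _.
  set I1 := m * _; set I2 := m * _ => conv intT.
  have -> : (kappa * rho * lam + kappa) * S t = kappa * rho * lam * S t + kappa * S t.
    by ring.
  lra.
apply: (@volterra_contraction _ (fun t => `|x t|) S T0 (kappa * rho) kappa).
- by rewrite mulr_ge0// ltW.
- exact: ltW.
- exact: Spos.
- move=> s t Ts st; apply: (Sigma_nd csigma t0_ge0 quad_var_t0); last exact: st.
  exact: le_trans Ts.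
- exact: S_pinfty.
- have cxT : {within `[T0, +oo[, continuous (fun t => `|x t|)}.
    have cxT : {within `[T0, +oo[, continuous x}.
      by apply: (continuous_subspaceW _ cx); apply: subset_itvr; rewrite bnd_simp.
    by apply: (within_continuous_compR (h := Num.norm) cxT) => y _; exact: norm_continuous.
  have cST : {within `[T0, +oo[, continuous (fun t => (S t)^-1)}.
    have cST : {within `[T0, +oo[, continuous S}.
      apply: (continuous_subspaceW _ (Sigma_continuous csigma t0_ge0 quad_var_t0)).
      by apply: subset_itvr; rewrite bnd_simp.
    apply: (within_continuous_compR (h := fun y => y^-1) cST) => y.
    rewrite /= in_itv/= andbT => /Spos Sy.
    by apply: inv_continuous; rewrite gt_eqF.
  by move=> t; apply: cvgM; [exact: cxT|exact: cST].
- exact: feedbackP.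
- exact: c0.
- exact: kc.
Qed.

End path.

(** * Conclusion *)

Section limsup.
Context {R : realType}.
Implicit Types (u : R -> \bar R).

Lemma limf_esup_le u (c : R) : (forall e : R, 0 < e ->
    \forall t \near +oo%R, (u t <= (c + e)%:E)%E) ->
  (limf_esup u +oo%R <= c%:E)%E.
Proof.
move=> uc; apply/lee_addgt0Pr => e e0; rewrite limf_esupE.
apply: (@le_trans _ _ (ereal_sup (u @` [set t | (u t <= (c + e)%:E)%E]))).
  by apply: ereal_inf_lbound; exists [set t | (u t <= (c + e)%:E)%E] => //; exact: uc.
by apply: ge_ereal_sup => _ [t ut <-].
Qed.

Lemma limf_einf_le_esup u : (limf_einf u +oo%R <= limf_esup u +oo%R)%E.
Proof.
rewrite limf_einfE limf_esupE; apply: ge_ereal_sup => _ [V nV <-].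
apply: le_ereal_inf_tmp => _ [W nW <-].
have [t [Vt Wt]] := filter_ex (filterI nV nW).
apply: (@le_trans _ _ (u t)).
  by apply: ereal_inf_lbound; exists t.
by apply: ereal_sup_ubound; exists t.
Qed.

End limsup.

Theorem theorem3p8 (R : realType) (d : measure_display) (T : measurableType d)
  (P : probability T R) (complete_P : measure_is_complete P)
  (F : R -> set (set T)) (usual_F : usual_filtration P F)
  (B : R -> T -> R) (brownian_B : brownian_motion P F B)
  (mu : {measure set (measurableTypeR R) -> \bar R})
  (mu_gt0 : (0 < mu `[0%R, +oo[%classic)%E) (mu_lty : (mu `[0%R, +oo[%classic < +oo)%E)
  (sigma : R -> R) (sigma_continuous : {within `[0, +oo[, continuous sigma})
  (sigma_notL2 : ~ lebesgue_measure.-integrable `]0%R, +oo[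
    (fun s : R => (sigma s ^+ 2)%:E))
  (f : R -> R) (f_lipschitz : [locally [lipschitz f x | x in [set: R]]])
  (f_pinfty : f x @[x --> +oo] --> +oo)
  (phi dphi : R -> R)
  (phi_gt0 : forall x : R, 0 <= x -> 0 < phi x)
  (phi_C1 : C1_with_derivative phi dphi)
  (dphi_gt0 : forall x : R, 0 <= x -> 0 < dphi x)
  (phi_pinfty : phi x @[x --> +oo] --> +oo)
  (dphi_nonincreasing : forall x y : R, 0 <= x -> x <= y -> dphi y <= dphi x)
  (dphi_cvg0 : dphi x @[x --> +oo] --> (0 : R))
  (f_phi : f x / phi x @[x --> +oo] --> (1 : R))
  (abs_f_phi : `|f x| / phi `|x| @[x --> abs_pinfty_nbhs] --> (1 : R))
  (X0 : T -> R) (X0_measurable : sub_measurable (F 0) X0)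
  (X : R -> T -> R)
  (X_solution : is_strong_solution P F B (kernel_of mu) f sigma X0 X)
  (t0 : R) (t0_ge0 : 0 <= t0) (quad_var_t0 : expR 1 < quad_var sigma t0)
  (L : R) (L_limit : Sigma_ratio mu f sigma t0 t @[t --> +oo] --> L)
  (L_gt1 : 1 < L) :
  {ae P, forall w,
    [/\ ((- L / (L - 1))%:E <=
          limf_einf (fun t : R => (X t w / Sigma sigma t)%:E) +oo%R)%E,
        (limf_einf (fun t : R => (X t w / Sigma sigma t)%:E) +oo%R <=
          limf_esup (fun t : R => (X t w / Sigma sigma t)%:E) +oo%R)%E &
        (limf_esup (fun t : R => (X t w / Sigma sigma t)%:E) +oo%R <=
          (L / (L - 1))%:E)%E]}.
Proof.
have [_ cX [M ito_M XE]] := X_solution.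
have q_pinfty := quad_var_pinfty sigma_continuous sigma_notL2.
(* Countably many values of kappa decreasing to 1 keep the union of the exceptional sets
   negligible. *)
have lilM (k : nat) : {ae P, forall w, \forall t \near +oo,
    `|M t w| <= (1 + k.+1%:R^-1) * Sigma sigma t}.
  apply: (ito_lil usual_F brownian_B sigma_continuous ito_M q_pinfty).
  by rewrite ltrDl invr_gt0.
have {}lilM : {ae P, forall w, forall k : nat, \forall t \near +oo,
    `|M t w| <= (1 + k.+1%:R^-1) * Sigma sigma t} by exact/ae_foralln.
apply: filterS3 cX lilM XE => w cXw lilw XEw.
have lilw' kappa : 1 < kappa -> \forall t \near +oo, `|M t w| <= kappa * Sigma sigma t.
  move=> k1; have k10 : 0 < kappa - 1 by rewrite subr_gt0.
  pose k := Num.truncn (kappa - 1)^-1.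
  have kk : 1 + (k.+1%:R : R)^-1 <= kappa.
    rewrite -lerBrDl invf_ple ?posrE//.
    have /truncn_itv/andP[_ /ltW//] : 0 <= (kappa - 1)^-1 by rewrite invr_ge0 ltW.
  apply: filterS (lilw k) => t Mt; apply: (le_trans Mt).
  by apply: ler_wpM2r => //; exact: sqrtr_ge0.
have bound c : L / (L - 1) < c ->
    \forall t \near +oo, `|X t w| <= c * Sigma sigma t.
  exact: (path_bound mu_gt0 mu_lty sigma_continuous q_pinfty f_lipschitz phi_gt0
    phi_C1 dphi_gt0 phi_pinfty dphi_nonincreasing f_phi abs_f_phi t0_ge0
    quad_var_t0 L_limit L_gt1 cXw XEw lilw').
have ratio e : 0 < e -> \forall t \near +oo,
    `|X t w / Sigma sigma t| <= L / (L - 1) + e.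
  move=> e0; have /bound := ltr_pwDr e0 (lexx (L / (L - 1))).
  apply: filterS2 (nbhs_pinfty_ge (num_real t0)) => t t0t Xt.
  have St := Sigma_gt0 sigma_continuous t0_ge0 quad_var_t0 t0t.
  by rewrite normrM normfV (gtr0_norm St) ler_pdivrMr.
split.
(* The lower limit is minus the upper limit of the opposite ratio, to which the bound on the
   absolute value applies equally. *)
- rewrite /limf_einf leeNr -EFinN mulNr opprK.
  apply: limf_esup_le => e /ratio; apply: filterS => t.
  by rewrite -EFinN lee_fin; apply: le_trans; rewrite -normrN ler_norm.
- exact: limf_einf_le_esup.
- apply: limf_esup_le => e /ratio; apply: filterS => t.
  by rewrite lee_fin; apply: le_trans; exact: ler_norm.
Qed.
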